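(* Let $A,B\in\mathbb{R}^{n\times n}$ and consider the linear delay-differential equation $\dot x(t)=Ax(t)+Bx(t-\tau)$. Let a curve of the asymptotic continuous spectrum cross the imaginary axis at $i\omega_H$, $\omega_H>0$, i.e. $\gamma_j(\pm\omega_H)=0$ for some $j\in\mathbb{N}$ and $\frac{d}{d\omega}\gamma_j(\omega_H)\neq0$. Then delay-induced crossings of the characteristic roots occur with $\lambda_H=i\omega_H$ at the following values of the time delay: $$\tau_k=\frac{1}{\omega_H}(\phi_H+2\pi k),\quad k\in\mathbb{Z},\qquad\text{where}\quad \phi_H=-\arg[Y_j(\omega_H)],$$ and $Y_j(\omega_H)$ is the corresponding root of the generating polynomial, $p_{\omega_H}(Y_j(\omega_H))=0$. This crossing is destabilizing if $\frac{d}{d\omega}\gamma_j(\omega_H)<0$ and stabilizing if $\frac{d}{d\omega}\gamma_j(\omega_H)>0$. If there are no other branches of the asymptotic continuous spectrum with $\gamma(\omega)=0$, then the crossings of the characteristic roots with $\lambda_H=i\omega_H$ at the time delays $\tau_k=\frac{1}{\omega_H}(\phi_H+2\pi k)$, $k\in\mathbb{Z}$, are the only delay-induced transverse crossings in the equation $\dot x(t)=Ax(t)+Bx(t-\tau)$.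
   Context: The DDE is $\dot x(t)=Ax(t)+Bx(t-\tau)$ with real $n\times n$ matrices $A,B$ and time delay $\tau$ regarded as a parameter. Its characteristic equation is $\chi(\lambda)=\det[\lambda I-A-Be^{-\lambda\tau}]=0$; solutions $\lambda$ are called characteristic roots. Since coefficients are real, roots occur in complex conjugate pairs and only $\omega_H>0$ is considered. Delay-induced transverse crossing at $\tau=\tau_H$: there is a family of roots $\lambda(\tau)=\alpha(\tau)\pm i\mu(\tau)$ of the characteristic equation with $\alpha(\tau_H)=0$ and $\frac{d\alpha}{d\tau}(\tau_H)\neq0$. It is called stabilizing if $\frac{d\alpha}{d\tau}(\tau_H)<0$ and destabilizing if $\frac{d\alpha}{d\tau}(\tau_H)>0$. Generating polynomial: $p_\omega(Y)=\det[i\omega I-A-BY]$. Asymptotic continuous spectrum (ACS): the collection of curves $\left\{\frac1\tau\gamma_j(\omega)+i\omega\right\}$, $\omega\in\mathbb{R}$, $j=1,\dots,m$, where $\gamma_j(\omega)=-\ln|Y_j(\omega)|$ and $Y_j(\omega)$ are the roots of the generating polynomial, $p_\omega(Y_j(\omega))=0$. Points $\omega$ for which the polynomial is degenerate, i.e. $p_\omega(Y)\equiv\det[i\omega I-A]$ for all $Y$, are excluded. A branch of the ACS is one of the functions $\gamma_j$.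
   Formalization: The root Y_j is assumed differentiable at ω_H (not only γ_j), and ''no other branches with γ(ω)=0'' also rules out further zeros of the same γ_j and branches whose limit at an excluded frequency has γ=0; without these the claim is false. *)

(* Defs.v *)
From HB Require Import structures.
From mathcomp Require Import all_boot all_order all_algebra.
From mathcomp Require Import all_classical all_reals all_analysis.
From mathcomp Require Import complex.

Set Implicit Arguments.
Unset Strict Implicit.
Unset Printing Implicit Defensive.

Import Order.TTheory GRing.Theory Num.Theory numFieldNormedType.Exports.

Local Open Scope classical_set_scope.
Local Open Scope ring_scope.
Local Open Scope complex_scope.

(* MathComp-Analysis has no complex exponential or argument, and puts no
   normed R-module structure on R[i]; limits and derivatives of functions
   R -> R[i] are therefore taken on the real and imaginary parts. *)

Definition cexp (R : realType) (z : R[i]) : R[i] :=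
  (expR (complex.Re z))%:C * (cos (complex.Im z) +i* sin (complex.Im z)).

(* Principal argument, with values in ]-pi, pi]. *)
Definition carg (R : realType) (z : R[i]) : R :=
  let t := acos (complex.Re z / Normc.normc z) in
  if 0 <= complex.Im z then t else - t.

Definition cmx (R : realType) (n : nat) (A : 'M[R]_n) : 'M[R[i]]_n :=
  map_mx (fun x : R => x%:C) A.

Definition ccontinuous_at (R : realType) (f : R -> R[i]) (t : R) : Prop :=
  {for t, continuous (fun s => complex.Re (f s))} /\
  {for t, continuous (fun s => complex.Im (f s))}.

Definition cderivable_at (R : realType) (f : R -> R[i]) (t : R) : Prop :=
  derivable (fun s => complex.Re (f s)) t 1 /\
  derivable (fun s => complex.Im (f s)) t 1.

Definition char_fun (R : realType) (n : nat) (A B : 'M[R]_n) (tau : R)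
    (lam : R[i]) : R[i] :=
  \det (lam%:M - cmx A - cexp (- (lam * tau%:C)) *: cmx B).

(* lam is a family of characteristic roots through i w at delay tau0; its
   conjugate is then a family through - i w, so that only w > 0 is kept. *)
Definition transverse_crossing (R : realType) (n : nat) (A B : 'M[R]_n)
    (tau0 w : R) (lam : R -> R[i]) : Prop :=
  let alpha := fun t => complex.Re (lam t) in
  [/\ 0 < w,
      lam tau0 = 0 +i* w,
      \forall t \near tau0,
        char_fun A B t (lam t) = 0 /\ ccontinuous_at lam t,
      derivable alpha tau0 1 &
      derive1 alpha tau0 != 0].

Definition stabilizing (R : realType) (tau0 : R) (lam : R -> R[i]) : Prop :=
  derive1 (fun t => complex.Re (lam t)) tau0 < 0.

Definition destabilizing (R : realType) (tau0 : R) (lam : R -> R[i]) : Prop :=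
  0 < derive1 (fun t => complex.Re (lam t)) tau0.

Definition gen_poly (R : realType) (n : nat) (A B : 'M[R]_n) (w : R)
    (y : R[i]) : R[i] :=
  \det ((0 +i* w)%:M - cmx A - y *: cmx B).

Definition degenerate (R : realType) (n : nat) (A B : 'M[R]_n) (w : R) : Prop :=
  forall y : R[i], gen_poly A B w y = \det ((0 +i* w)%:M - cmx A).

(* The root y = 0 is left out: it corresponds to gamma = +oo, whereas
   ln 0 = 0 in the library would place it on the imaginary axis. *)
Definition acs_root (R : realType) (n : nat) (A B : 'M[R]_n) (w : R)
    (y : R[i]) : Prop :=
  [/\ ~ degenerate A B w, gen_poly A B w y = 0 & y != 0].

(* Y parametrizes, near w0, a curve of the asymptotic continuous spectrum.
   The frequency w0 itself may be degenerate, hence excluded from the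
   spectrum; Y w0 is then the limit of the curve at w0. *)
Definition acs_branch (R : realType) (n : nat) (A B : 'M[R]_n) (w0 : R)
    (Y : R -> R[i]) : Prop :=
  [/\ \forall w \near w0^', acs_root A B w (Y w),
      ccontinuous_at Y w0 &
      Y w0 != 0].

Definition acs_gamma (R : realType) (Y : R -> R[i]) (w : R) : R :=
  - ln (Normc.normc (Y w)).

Definition crossing_delay (R : realType) (w : R) (y : R[i]) (k : int) : R :=
  (- carg y + 2 * pi * k%:~R) / w.

(* Main.v *)
(* Put lambda_0 = i wH and Y_0 = Y(wH) = exp(- lambda_0 tau), tau being one of
   the delays tau_k. Characteristic roots solve P(lambda, exp(- lambda t)) = 0
   with P polynomial, and Y_0 may be a multiple root of P(lambda_0, .), so that
   the implicit function theorem is not available. Blow up the crossing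
   instead: with lambda = lambda_0 + theta u and t = tau + theta, the equation
   divided by theta^r, r the order of P at (lambda_0, Y_0), becomes
   H(u, theta) = 0, where H(., 0) is the tangent cone of P = 0 restricted to the
   line dY = - Y_0 (lambda_0 + tau u) dtheta. This line misses the origin, so
   H(., 0) is a nonzero polynomial; as Y is differentiable at wH, (i, Y'(wH)) is
   in the cone, whence a root beta = wH / (Y'(wH) / Y_0 + i tau) of H(., 0),
   whose real part has the sign of - gamma'(wH). A continuous family of zeros
   u(theta) with u(0) = beta yields the crossing lambda_0 + theta u(theta), of
   derivative beta at theta = 0. Continuous families of zeros exist for uniform
   limits of polynomials: the zeros in a disc are uniformly few and move with a
   uniform modulus of continuity, so that walks through the zeros at the times
   of a finer and finer grid have a limit along an ultrafilter.

   Conversely, let i w be crossed transversally at delay t and put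
   y_0 = exp(- i w t). Factoring P(i w + x, y_0 + y) = x^m Q'(x, y) with
   Q'(0, .) nonzero, the crossing family (x <> 0 near t) forces Q'(0, 0) = 0, so
   that Q'(x, .) has roots tending to 0 with x: they form a branch of the
   spectrum through y_0, on which gamma vanishes. *)
Require Import Defs.
From mathcomp Require Import all_boot all_order all_algebra.
From mathcomp Require Import all_classical all_reals all_analysis.
From mathcomp Require Import complex.
From mathcomp Require Import ring lra.
Import Order.TTheory GRing.Theory Num.Theory numFieldNormedType.Exports.
Local Open Scope classical_set_scope.
Local Open Scope ring_scope.

Set Implicit Arguments.
Unset Strict Implicit.
Unset Printing Implicit Defensive.

Local Notation N := Normc.normc.

(** * The modulus on [R[i]] as a real-valued norm *)

Section Modulus.
Local Open Scope complex_scope.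
Context {R : realType}.
Implicit Types (z w : R[i]).

Lemma normc_ge0 z : 0 <= N z.
Proof. by case: z => a b; exact: sqrtr_ge0. Qed.

Lemma normc_eq0 z : (N z == 0) = (z == 0).
Proof.
by apply/eqP/eqP => [/Normc.eq0_normc|->]; rewrite ?Normc.normc0.
Qed.

Lemma normc_gt0 z : (0 < N z) = (z != 0).
Proof. by rewrite lt0r normc_ge0 andbT normc_eq0. Qed.

Lemma normcX z n : N (z ^+ n) = N z ^+ n.
Proof.
by elim: n => [|n IH]; rewrite ?expr0 ?Normc.normc1 // !exprS Normc.normcM IH.
Qed.

Lemma normc_real (x : R) : N x%:C = `|x|.
Proof. by rewrite /= expr0n /= addr0 sqrtr_sqr. Qed.

Lemma normc_imag (x : R) : N (0 +i* x)%C = `|x|.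
Proof. by rewrite /= expr0n /= add0r sqrtr_sqr. Qed.

Lemma normc_opp z : N (- z) = N z.
Proof. exact: complex.normcN. Qed.

Lemma ler_normcD z w : N (z + w) <= N z + N w.
Proof. exact: complex.le_normcD. Qed.

Lemma normcBC z w : N (z - w) = N (w - z).
Proof. by rewrite -normc_opp opprB. Qed.

Lemma ler_normcB z w : N (z - w) <= N z + N w.
Proof. by rewrite -(normc_opp w); exact: ler_normcD. Qed.

Lemma ler_normc_dist z w : N z - N w <= N (z - w).
Proof.
by rewrite lerBlDr -{1}(subrK w z); exact: ler_normcD.
Qed.

Lemma ler_normc_distD w z t : N (z - t) <= N (z - w) + N (w - t).
Proof.
have -> : z - t = (z - w) + (w - t) by ring.
exact: ler_normcD.
Qed.

Lemma normc_sum I (r : seq I) (F : I -> R[i]) :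
  N (\sum_(i <- r) F i) <= \sum_(i <- r) N (F i).
Proof.
elim: r => [|i r IH]; first by rewrite !big_nil Normc.normc0.
by rewrite !big_cons; apply: le_trans (ler_normcD _ _) _; rewrite lerD2l.
Qed.

Lemma normc_prod I (r : seq I) (F : I -> R[i]) :
  N (\prod_(i <- r) F i) = \prod_(i <- r) N (F i).
Proof. exact: (big_morph _ (@Normc.normcM R) (@Normc.normc1 R)). Qed.

Lemma normc_Re z : `|complex.Re z| <= N z.
Proof.
case: z => a b /=.
by rewrite -sqrtr_sqr ler_sqrt ?addr_ge0 ?sqr_ge0 // lerDl sqr_ge0.
Qed.

Lemma normc_Im z : `|complex.Im z| <= N z.
Proof.
case: z => a b /=.
by rewrite -sqrtr_sqr ler_sqrt ?addr_ge0 ?sqr_ge0 // lerDr sqr_ge0.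
Qed.

Lemma normc_le_ReIm z : N z <= `|complex.Re z| + `|complex.Im z|.
Proof.
case: z => a b; have -> : (a +i* b)%C = a%:C + (0 +i* b)%C.
  by apply/eqP; rewrite eq_complex /= addr0 add0r !eqxx.
apply: le_trans (ler_normcD _ _) _.
by rewrite normc_real normc_imag /= addr0 add0r.
Qed.

End Modulus.

(** * Polynomial functions of two complex variables *)

Section BivariatePolynomials.
Local Open Scope complex_scope.
Context {R : realType}.
Notation C := R[i].

(** A predicate on functions: bounds and Lipschitz constants follow by induction on the way the
    function is built. *)
Inductive bipoly : (C -> C -> C) -> Prop :=
| bipoly_const c : bipoly (fun _ _ => c)
| bipoly_fst : bipoly (fun x _ => x)
| bipoly_snd : bipoly (fun _ y => y)
| bipoly_add f g : bipoly f -> bipoly g -> bipoly (fun x y => f x y + g x y)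
| bipoly_mul f g : bipoly f -> bipoly g -> bipoly (fun x y => f x y * g x y).

Lemma bipoly_exp f n : bipoly f -> bipoly (fun x y => f x y ^+ n).
Proof.
move=> bf; elim: n => [|n IH].
  by under eq_fun do under eq_fun do rewrite expr0; exact: bipoly_const.
by under eq_fun do under eq_fun do rewrite exprS; exact: bipoly_mul.
Qed.

Lemma bipoly_sum I (r : seq I) (F : I -> C -> C -> C) :
  (forall i, bipoly (F i)) -> bipoly (fun x y => \sum_(i <- r) F i x y).
Proof.
move=> bF; elim: r => [|i r IH].
  by under eq_fun do under eq_fun do rewrite big_nil; exact: bipoly_const.
by under eq_fun do under eq_fun do rewrite big_cons; exact: bipoly_add.
Qed.

Lemma bipoly_bounded f B : bipoly f -> exists2 K, 0 < K &
  forall x y, N x <= B -> N y <= B -> N (f x y) <= K.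
Proof.
have [B0|B0] := ltP B 0.
  move=> _; exists 1 => // x y xB.
  by have := lt_le_trans (le_lt_trans xB B0) (normc_ge0 x); rewrite ltxx.
elim=> {f} [c|||f g _ [K K0 bK] _ [L L0 bL]|f g _ [K K0 bK] _ [L L0 bL]].
- by exists (N c + 1); [rewrite ltr_wpDl ?normc_ge0|move=> *; rewrite lerDl].
- by exists (B + 1); [rewrite ltr_wpDl|move=> x y xB _; rewrite ler_wpDr].
- by exists (B + 1); [rewrite ltr_wpDl|move=> x y _ xB; rewrite ler_wpDr].
- exists (K + L); first exact: addr_gt0.
  move=> x y hx hy; apply: le_trans (ler_normcD _ _) _.
  by apply: lerD; [exact: bK|exact: bL].
- exists (K * L); first exact: mulr_gt0.
  move=> x y hx hy; rewrite Normc.normcM.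
  by apply: ler_pM; rewrite ?normc_ge0 ?bK ?bL.
Qed.

Lemma bipoly_lipschitz f B : bipoly f -> exists2 K, 0 < K &
  forall x y x' y', N x <= B -> N y <= B -> N x' <= B -> N y' <= B ->
    N (f x y - f x' y') <= K * (N (x - x') + N (y - y')).
Proof.
elim=> {f} [c|||f g _ [K K0 lK] _ [L L0 lL]|f g bf [K K0 lK] bg [L L0 lL]].
- exists 1 => // x y x' y' *.
  by rewrite subrr Normc.normc0 mul1r addr_ge0 ?normc_ge0.
- by exists 1 => // x y x' y' *; rewrite mul1r lerDl normc_ge0.
- by exists 1 => // x y x' y' *; rewrite mul1r lerDr normc_ge0.
- exists (K + L); first exact: addr_gt0.
  move=> x y x' y' *; rewrite opprD addrACA mulrDl.
  apply: le_trans (ler_normcD _ _) _.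
  by apply: lerD; [exact: lK|exact: lL].
- have [F F0 bF] := bipoly_bounded B bf; have [G G0 bG] := bipoly_bounded B bg.
  exists (F * L + K * G); first by rewrite addr_gt0 ?mulr_gt0.
  move=> x y x' y' hx hy hx' hy'.
  have -> : f x y * g x y - f x' y' * g x' y' =
    f x y * (g x y - g x' y') + (f x y - f x' y') * g x' y' by ring.
  apply: le_trans (ler_normcD _ _) _; rewrite !Normc.normcM mulrDl.
  apply: lerD.
    rewrite -mulrA; apply: ler_pM; rewrite ?normc_ge0 ?bF ?lL //.
  by rewrite mulrAC; apply: ler_pM; rewrite ?normc_ge0 ?bG ?lK.
Qed.

Lemma bipoly_polyl f y : bipoly f -> exists p : {poly C}, forall x, f x y = p.[x].
Proof.
elim=> {f} [c|||f g _ [p hp] _ [q hq]|f g _ [p hp] _ [q hq]].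
- by exists c%:P => x; rewrite hornerC.
- by exists 'X => x; rewrite hornerX.
- by exists y%:P => x; rewrite hornerC.
- by exists (p + q) => x; rewrite hornerD hp hq.
- by exists (p * q) => x; rewrite hornerM hp hq.
Qed.

Lemma bipoly_horner (p : {poly C}) : bipoly (fun x _ => p.[x]).
Proof.
under eq_fun do under eq_fun do rewrite horner_coef.
apply: bipoly_sum => i; apply: bipoly_mul; first exact: bipoly_const.
exact/bipoly_exp/bipoly_fst.
Qed.

(** Convention for [{poly {poly C}}]: the coefficients are polynomials in [x], the outer variable is
    [y]. *)
Lemma horner2E (Q : {poly {poly C}}) x y :
  Q.[y%:P].[x] = \sum_(i < size Q) (Q`_i).[x] * y ^+ i.
Proof.
rewrite (horner_coef Q) horner_sum; apply: eq_bigr => i _.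
by rewrite hornerM -polyC_exp hornerC.
Qed.

Lemma bipoly_horner2 (Q : {poly {poly C}}) : bipoly (fun x y => Q.[y%:P].[x]).
Proof.
under eq_fun do under eq_fun do rewrite horner2E.
apply: bipoly_sum => i; apply: bipoly_mul; first exact: bipoly_horner.
exact/bipoly_exp/bipoly_snd.
Qed.

Lemma poly_lipschitz (p : {poly C}) B : exists2 K, 0 < K &
  forall x y, N x <= B -> N y <= B -> N (p.[x] - p.[y]) <= K * N (x - y).
Proof.
have [K K0 lK] := bipoly_lipschitz B (bipoly_horner p).
exists K => // x y hx hy.
by have := lK x x y x hx hx hy hx; rewrite [x - x]subrr Normc.normc0 addr0.
Qed.

Lemma poly_bounded (p : {poly C}) B : exists2 K, 0 < K &
  forall x, N x <= B -> N p.[x] <= K.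
Proof.
have [K K0 lK] := bipoly_bounded B (bipoly_horner p).
by exists K => // x hx; apply: (lK x x hx hx).
Qed.

End BivariatePolynomials.

(** * Maximum and minimum principles; counting zeros in discs *)

Section PolynomialsOnDiscs.
Local Open Scope complex_scope.
Context {R : realType}.
Notation C := R[i].
Implicit Types (p q V : {poly C}).

Lemma ler_prod_exp (T : eqType) (s : seq T) (f : T -> R) t : 0 <= t ->
  (forall x, x \in s -> t <= f x) -> t ^+ size s <= \prod_(x <- s) f x.
Proof.
move=> t0; elim: s => [|x s IH] h; first by rewrite big_nil.
rewrite big_cons exprS; apply: ler_pM; rewrite ?exprn_ge0 //.
  by apply: h; rewrite mem_head.
by apply: IH => y ys; apply: h; rewrite inE ys orbT.
Qed.

Lemma ler_prod_expr (T : eqType) (s : seq T) (f : T -> R) t :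
  (forall x, x \in s -> 0 <= f x <= t) -> \prod_(x <- s) f x <= t ^+ size s.
Proof.
elim: s => [|x s IH] h; first by rewrite big_nil.
rewrite big_cons exprS.
have /andP[fx0 fxt] := h x (mem_head _ _).
have hs y : y \in s -> 0 <= f y <= t by move=> ys; apply: h; rewrite inE ys orbT.
apply: ler_pM => //; last exact: IH.
by rewrite big_seq; apply: prodr_ge0 => y /hs /andP[].
Qed.

(** Over [C] the polynomial splits, and each linear factor has modulus at least [d] at [x]. Read
    backwards, a small value forces a root nearby. *)
Lemma roots_far q x d : q != 0 -> 0 <= d ->
  (forall z, root q z -> d <= N (x - z)) ->
  N (lead_coef q) * d ^+ (size q).-1 <= N q.[x].
Proof.
move=> q0 d0 far; have [r qE] := closed_field_poly_normal q.
have sr : size r = (size q).-1.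
  by rewrite [in RHS]qE size_scale ?lead_coef_eq0 // size_prod_XsubC.
rewrite -sr [in leRHS]qE hornerZ horner_prod Normc.normcM normc_prod.
apply: ler_wpM2l; rewrite ?normc_ge0 //; apply: ler_prod_exp => // z zr.
rewrite hornerXsubC; apply: far; rewrite qE rootZ ?lead_coef_eq0 //.
by rewrite root_prod_XsubC.
Qed.

Lemma normc_divlM (z : C) (a : R) : z != 0 -> 0 <= a ->
  N ((a / N z)%:C * z) = a.
Proof.
move=> z0 a0; have Nz : N z != 0 by rewrite normc_eq0.
by rewrite Normc.normcM normc_real ger0_norm ?divr_ge0 ?normc_ge0 // divfK.
Qed.

(* Preimages move little when the value does; they cannot leave the disc as
   long as the value stays away from those taken on the boundary circle. *)
Lemma value_step V rho mu : (1 < size V)%N -> 0 < rho -> 0 < mu ->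
  exists2 eta, 0 < eta & forall w z, N z <= rho -> N (V.[z] - w) < eta ->
    (forall u, N u = rho -> mu <= N (V.[u] - w)) ->
    exists2 z', N z' <= rho & V.[z'] = w.
Proof.
move=> sV rho0 mu0; have [K K0 lK] := poly_lipschitz V (rho + 1).
(* A root [z'] of [V - w] within [d] of [z], if outside the disc, is within [d] of the circle, where
   [V] would then be within [K * d <= mu / 2] of [w]. The bound [d <= 1] keeps [z'] where [K] is
   valid. *)
set d := Num.min 1 (mu / (2 * K)).
have d0 : 0 < d by rewrite lt_min ltr01 divr_gt0 ?mulr_gt0.
have V0 : V != 0 by rewrite -size_poly_gt0 ltnW.
exists (N (lead_coef V) * d ^+ (size V).-1).
  by rewrite mulr_gt0 ?exprn_gt0 // normc_gt0 lead_coef_eq0.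
move=> w z zrho hz hw.
have sw : (size (- w%:P) < size V)%N.
  by rewrite size_polyN; apply: leq_ltn_trans (size_polyC_leq1 _) _.
have sVw : size (V - w%:P) = size V by rewrite size_polyDl.
have [z' [rz' dz']] : exists z', root (V - w%:P) z' /\ N (z - z') < d.
  apply/not_existsP => no.
  move: hz; rewrite ltNge => /negP; apply.
  have := @roots_far (V - w%:P) z d; rewrite hornerD hornerN hornerC.
  rewrite sVw lead_coefDl //; apply.
  - by rewrite -size_poly_gt0 sVw ltnW.
  - exact: ltW.
  - by move=> y ry; rewrite leNgt; apply/negP => yd; apply: (no y).
move: rz'; rewrite rootE hornerD hornerN hornerC subr_eq0 => /eqP Vz'.
have [z'rho|z'rho] := leP (N z') rho; first by exists z'.
have z'0 : z' != 0 by rewrite -normc_gt0 (lt_trans rho0).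
set u := (rho / N z')%:C * z'.
have Nu : N u = rho by rewrite normc_divlM // ltW.
have z'u : N (z' - u) < d.
  have -> : z' - u = ((N z' - rho) / N z')%:C * z'.
    rewrite mulrBl divff ?normc_eq0 // /u rmorphB rmorph1 mulrBl mul1r //.
  rewrite normc_divlM ?subr_ge0 ?(ltW z'rho) //.
  apply: le_lt_trans dz'; rewrite normcBC.
  by apply: le_trans (ler_normc_dist _ _); rewrite lerB.
have d1 : d <= 1 by rewrite ge_min lexx.
have dmu : d <= mu / (2 * K) by rewrite ge_min lexx orbT.
have z'1 : N z' <= rho + 1.
  have := ler_normc_dist z' z; rewrite normcBC; lra.
have u1 : N u <= rho + 1 by rewrite Nu lerDl.
have := hw _ Nu; rewrite -Vz' normcBC => h.
have := le_trans h (lK _ _ z'1 u1).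
have : K * N (z' - u) < K * d by rewrite ltr_pM2l.
have : K * d <= mu / 2.
  by rewrite mulrC -ler_pdivlMr // -mulrA -invfM.
lra.
Qed.

Lemma poly_size_le1 V x y : (size V <= 1)%N -> V.[x] = V.[y].
Proof. by move=> /size1_polyC ->; rewrite !hornerC. Qed.

(** If [N V.[z]] exceeded [c], the value could be pushed outward along its ray in equal steps for
    ever, [value_step] keeping the preimages in the disc, where [V] is bounded. *)
Lemma max_modulus V rho c : 0 < rho ->
  (forall u, N u = rho -> N V.[u] <= c) ->
  forall z, N z <= rho -> N V.[z] <= c.
Proof.
move=> rho0 hc z zrho; have Nrho : N rho%:C = rho by rewrite normc_real gtr0_norm.
have [sV|sV] := leqP (size V) 1.
  by rewrite (@poly_size_le1 V z rho%:C) // hc.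
rewrite leNgt; apply/negP => cz.
have c0 : 0 <= c := le_trans (normc_ge0 _) (hc _ Nrho).
have w0 : 0 < N V.[z] := le_lt_trans c0 cz.
have [|eta eta0 step] := value_step sV rho0 (mu := N V.[z] - c).
  by rewrite subr_gt0.
have [e e0 eE] : exists2 e, 0 < e & e * N V.[z] = eta / 2.
  exists (eta / (2 * N V.[z])); first by rewrite divr_gt0 ?mulr_gt0.
  by field; rewrite gt_eqF.
have pos j : 0 <= 1 + j%:R * e by rewrite addr_ge0 // mulr_ge0 // ltW.
have val j : exists2 z', N z' <= rho & V.[z'] = (1 + j%:R * e)%:C * V.[z].
  elim: j => [|j [z' z'rho z'E]]; first by exists z; rewrite // mul0r addr0 mul1r.
  apply: (step _ z') => //.
    have -> : V.[z'] - (1 + j.+1%:R * e)%:C * V.[z] = (- e)%:C * V.[z].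
      rewrite z'E -mulrBl -rmorphB; congr (_%:C * _).
      by rewrite -natr1; ring.
    rewrite Normc.normcM normc_real normrN gtr0_norm // eE; lra.
  move=> u Nu; apply: le_trans; last first.
    by rewrite normcBC; exact: ler_normc_dist.
  apply: lerB; last exact: hc.
  rewrite Normc.normcM normc_real ger0_norm //.
  by rewrite ler_pMl // lerDl mulr_ge0 // ltW.
have [K K0 bK] := poly_bounded V rho.
have := archi_boundP (ltW (divr_gt0 K0 (mulr_gt0 e0 w0))).
set m := Num.bound _ => hj.
have [z' z'rho z'E] := val m.
have := bK _ z'rho; rewrite z'E Normc.normcM normc_real ger0_norm //.
move: hj; rewrite ltr_pdivrMr ?mulr_gt0 // mulrDl mul1r mulrA.
lra.
Qed.

(** Minimum principle: the value is shrunk from [V.[z]] to [0] in [n] equal steps, followed by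
    preimages inside the disc. *)
Lemma small_value_root V rho c : 0 < rho ->
  (forall u, N u = rho -> c <= N V.[u]) ->
  forall z, N z <= rho -> N V.[z] < c ->
  exists2 x, N x <= rho & root V x.
Proof.
move=> rho0 hc z zrho cz; have Nrho : N rho%:C = rho by rewrite normc_real gtr0_norm.
have [sV|sV] := leqP (size V) 1.
  by move: cz; rewrite (@poly_size_le1 V z rho%:C) // ltNge hc.
have [|eta eta0 step] := value_step sV rho0 (mu := c - N V.[z]).
  by rewrite subr_gt0.
have := archi_boundP (divr_ge0 (normc_ge0 V.[z]) (ltW eta0)).
set n := Num.bound _ => hn.
have n0 : 0 < n%:R :> R.
  by apply: le_lt_trans hn; rewrite divr_ge0 ?normc_ge0 // ltW.
have val j : (j <= n)%N ->
    exists2 z', N z' <= rho & V.[z'] = (1 - j%:R / n%:R)%:C * V.[z].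
  elim: j => [_|j IH jn]; first by exists z; rewrite // mul0r subr0 mul1r.
  have [z' z'rho z'E] := IH (ltnW jn).
  apply: (step _ z') => //.
    have -> : V.[z'] - (1 - j.+1%:R / n%:R)%:C * V.[z] = (n%:R^-1)%:C * V.[z].
      rewrite z'E -mulrBl -rmorphB; congr (_%:C * _).
      by rewrite -natr1; ring.
    rewrite Normc.normcM normc_real gtr0_norm ?invr_gt0 // mulrC.
    by rewrite ltr_pdivrMr // mulrC -ltr_pdivrMr.
  move=> u Nu; apply: le_trans (ler_normc_dist _ _); apply: lerB; first exact: hc.
  have jn1 : j.+1%:R / n%:R <= 1 :> R by rewrite ler_pdivrMr // mul1r ler_nat.
  rewrite Normc.normcM normc_real ger0_norm ?subr_ge0 //.
  by rewrite ler_piMl ?normc_ge0 // gerBl divr_ge0.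
have [x xrho] := val n (leqnn n).
rewrite divff ?gt_eqF // subrr mul0r => xE.
by exists x => //; apply/rootP.
Qed.

(** Turns [c * (3 / 2) ^+ m <= K] into the linear bound [m <= 2 * K / c] on a number of zeros. *)
Lemma bernoulli_half m : 1 + m%:R / 2 <= (3 / 2) ^+ m :> R.
Proof.
elim: m => [|m IH]; first by rewrite mul0r addr0 expr0.
rewrite exprS -natr1; have : 0 <= m%:R :> R by [].
lra.
Qed.

(* [q] factors as [\prod_(z <- Z) ('X - z) * V] with [V] free of zeros in the
   disc: the minimum principle bounds [V] from below, the maximum principle on
   the circle of radius [4 rho] bounds the number of factors (Jensen). *)
Lemma roots_in_disc q rho c K : 0 < rho -> 0 < c ->
  (forall u, N u = rho -> c <= N q.[u]) ->
  (forall u, N u <= 4 * rho -> N q.[u] <= K) ->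
  exists Z : seq C,
   [/\ (size Z <= Num.truncn (2 * K / c))%N,
       forall z, z \in Z -> root q z /\ N z <= rho &
       forall e x, 0 < e <= 2 * rho -> N x <= rho ->
         N q.[x] < c * (e / (2 * rho)) ^+ Num.truncn (2 * K / c) ->
         exists2 z, z \in Z & N (x - z) <= e].
Proof.
move=> rho0 c0 hc hK; have Nrho : N rho%:C = rho by rewrite normc_real gtr0_norm.
have q0 : q != 0.
  by apply/eqP => q0; have := hc _ Nrho; rewrite q0 horner0 Normc.normc0 leNgt c0.
have [r qE] := closed_field_poly_normal q.
set Z := [seq z <- r | N z <= rho].
set V := lead_coef q *: \prod_(z <- r | ~~ (N z <= rho)) ('X - z%:P).
have qZV : q = (\prod_(z <- Z) ('X - z%:P)) * V.
  by rewrite {1}qE (bigID (fun z => N z <= rho)) /= -scalerAr big_filter.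
have qx x : N q.[x] = (\prod_(z <- Z) N (x - z)) * N V.[x].
  rewrite qZV hornerM horner_prod Normc.normcM normc_prod; congr (_ * _).
  by apply: eq_bigr => z _; rewrite hornerXsubC.
have Zrho z : z \in Z -> N z <= rho by rewrite mem_filter => /andP[].
have Zq z : z \in Z -> root q z.
  rewrite mem_filter => /andP[_ zr].
  by rewrite qE rootZ ?lead_coef_eq0 // root_prod_XsubC.
have VN0 x : N x <= rho -> ~~ root V x.
  move=> xrho; rewrite rootZ ?lead_coef_eq0 // -big_filter root_prod_XsubC.
  by rewrite mem_filter xrho.
have r2 : 0 < 2 * rho by rewrite mulr_gt0.
(* A zero in the disc is at most [2 * rho] away from points of the circle of radius [rho], and at
   least [3 * rho] away from those of radius [4 * rho], whence the ratio [3 / 2]. *)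
have Vcirc u : N u = rho -> c / (2 * rho) ^+ size Z <= N V.[u].
  move=> Nu; rewrite ler_pdivrMr ?exprn_gt0 // mulrC.
  apply: le_trans (hc _ Nu) _; rewrite qx; apply: ler_wpM2r; first exact: normc_ge0.
  apply: ler_prod_expr => z zZ; rewrite normc_ge0 /=.
  by apply: le_trans (ler_normcB _ _) _; rewrite Nu; have := Zrho _ zZ; lra.
have Vdisc x : N x <= rho -> c / (2 * rho) ^+ size Z <= N V.[x].
  move=> xrho; rewrite leNgt; apply/negP => h.
  have [y yrho] := small_value_root rho0 Vcirc xrho h.
  by apply/negP; exact: VN0.
have K0 : 0 < K.
  apply: lt_le_trans c0 (le_trans (hc _ Nrho) (hK _ _)); rewrite Nrho; lra.
have r3 : 0 < 3 * rho by rewrite mulr_gt0.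
have sZ : (size Z <= Num.truncn (2 * K / c))%N.
  have V4 : forall u, N u = 4 * rho -> N V.[u] <= K / (3 * rho) ^+ size Z.
    move=> u Nu; rewrite ler_pdivlMr ?exprn_gt0 // mulrC.
    apply: le_trans (hK u _); rewrite ?Nu // qx.
    apply: ler_wpM2r; first exact: normc_ge0.
    apply: ler_prod_exp => [|z zZ]; first exact: ltW.
    apply: le_trans (ler_normc_dist _ _); rewrite Nu.
    by have := Zrho _ zZ; lra.
  have Vle : N V.[rho%:C] <= K / (3 * rho) ^+ size Z.
    by apply: (max_modulus _ V4); rewrite ?mulr_gt0 // Nrho; lra.
  have := le_trans (Vcirc _ Nrho) Vle.
  rewrite ler_pdivrMr ?exprn_gt0 // mulrAC ler_pdivlMr ?exprn_gt0 //.
  rewrite !exprMn !mulrA ler_pM2r ?exprn_gt0 // => h.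
  have h2 : c * (3 / 2) ^+ size Z <= K.
    by rewrite expr_div_n mulrA ler_pdivrMr ?exprn_gt0.
  have h3 : (size Z)%:R <= 2 * K / c.
    rewrite ler_pdivlMr //.
    have : c * (1 + (size Z)%:R / 2) <= c * (3 / 2) ^+ size Z.
      by rewrite ler_pM2l // bernoulli_half.
    lra.
  rewrite truncn_ge_nat //.
  by rewrite divr_ge0 ?mulr_ge0 // ltW.
exists Z; split=> // [z zZ|e x /andP[e0 e2] xrho hx]; first by split; auto.
apply: contrapT => /forall2NP far; move: hx; rewrite ltNge => /negP; apply.
have farZ z : z \in Z -> e <= N (x - z).
  by move=> zZ; have [|/negP] := far z; rewrite ?zZ // -ltNge => /ltW.
rewrite qx; apply: (@le_trans _ _ (e ^+ size Z * (c / (2 * rho) ^+ size Z))).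
  rewrite mulrCA -expr_div_n; apply: ler_wpM2l; first exact: ltW.
  (* As [e / (2 * rho) <= 1], the exponent [size Z] may be raised to its upper bound. *)
  apply: ler_wiXn2l => //; first by rewrite divr_ge0 // ltW.
  by rewrite ler_pdivrMr // mul1r.
apply: ler_pM; rewrite ?exprn_ge0 ?divr_ge0 ?exprn_ge0 ?(ltW e0) ?(ltW c0) ?(ltW r2) //.
  by apply: ler_prod_exp => //; exact: ltW.
exact: Vdisc.
Qed.

(** A radius below the moduli of all nonzero roots avoids the roots; [c] comes from the reverse
    triangle inequality in each linear factor. *)
Lemma isolating_circle q e : q != 0 -> 0 < e ->
  exists rho c, [/\ 0 < rho < e, 0 < c & forall u, N u = rho -> c <= N q.[u]].
Proof.
move=> q0 e0; have [r qE] := closed_field_poly_normal q.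
have [d d0 hd] : exists2 d, 0 < d & forall z, z \in r -> N z = 0 \/ d < N z.
  elim: r {qE} => [|z r [d d0 hd]]; first by exists 1.
  have [z0|z0] := eqVneq (N z) 0.
    exists d => // y; rewrite inE => /orP[/eqP->|/hd //]; by left.
  have Nz : 0 < N z by rewrite lt0r z0 normc_ge0.
  exists (Num.min d (N z / 2)); first by rewrite lt_min d0 divr_gt0.
  move=> y; rewrite inE gt_min => /orP[/eqP->|/hd[->|dy]]; [right|by left|right].
    by apply/orP; right; lra.
  by rewrite dy.
set rho := Num.min d e / 2.
have m0 : 0 < Num.min d e by rewrite lt_min d0.
have rho0 : 0 < rho by rewrite divr_gt0.
have md : Num.min d e <= d by rewrite ge_min lexx.
have me : Num.min d e <= e by rewrite ge_min lexx orbT.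
have rd : rho < d by rewrite /rho; lra.
have re : rho < e by rewrite /rho; lra.
exists rho, (N (lead_coef q) * \prod_(z <- r) `|rho - N z|); split.
- by rewrite rho0 re.
- rewrite mulr_gt0 ?normc_gt0 ?lead_coef_eq0 // big_seq prodr_gt0 // => z zr.
  rewrite normr_gt0 subr_eq0; apply/eqP => rz.
  by case: (hd _ zr); rewrite -rz; lra.
- move=> u Nu; rewrite [in leRHS]qE hornerZ horner_prod Normc.normcM normc_prod.
  apply: ler_wpM2l; first exact: normc_ge0.
  apply: ler_prod => z _; rewrite normr_ge0 /= hornerXsubC -Nu ler_norml.
  by rewrite lerNl opprB {1}normcBC !ler_normc_dist.
Qed.

End PolynomialsOnDiscs.

(** * Continuous selection of zeros along a real parameter *)

Section ContinuousSelection.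
Local Open Scope complex_scope.
Context {R : realType}.
Notation C := R[i].

Lemma path_dist (d : R) (a : C) p : path (fun x y => N (x - y) <= d) a p ->
  N (a - last a p) <= (size p)%:R * d.
Proof.
elim: p a => [|b p IH] a /=; first by rewrite subrr Normc.normc0 mul0r.
move=> /andP[ab /IH bl]; apply: le_trans (ler_normc_distD b _ _) _.
by rewrite -natr1 mulrDl mul1r addrC lerD.
Qed.

(* A walk with steps [e] inside the [e]-neighbourhood of a finite set stays in
   one cluster of that set: shorten the induced walk on the centres. *)
Lemma chain_dist (Z : seq C) (x : nat -> C) e k : 0 <= e ->
  (forall l, (l <= k)%N -> exists2 z, z \in Z & N (x l - z) <= e) ->
  (forall l, (l < k)%N -> N (x l - x l.+1) <= e) ->
  N (x 0%N - x k) <= ((size Z)%:R * 3 + 2) * e.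
Proof.
move=> e0 near step; pose r (a b : C) := N (a - b) <= e *+ 3.
have [a [p [aZ x0a rp pZ xkp]]] : exists a p, [/\ a \in Z, N (x 0%N - a) <= e,
    path r a p, {subset p <= Z} & N (x k - last a p) <= e].
  elim: k near step => [|k IH] near step.
    by have [z zZ hz] := near 0%N isT; exists z, [::].
  have [l lk|l lk|a [p [aZ x0a rp pZ xkp]]] := IH.
  - by apply: near; exact: leqW.
  - by apply: step; exact: leqW.
  have [z zZ hz] := near k.+1 (leqnn _).
  exists a, (rcons p z); split => //; last by rewrite last_rcons.
    rewrite rcons_path rp /= /r; apply: le_trans (ler_normc_distD (x k) _ _) _.
    rewrite mulrS; apply: lerD; first by rewrite normcBC.
    apply: le_trans (ler_normc_distD (x k.+1) _ _) _.
    by rewrite mulr2n lerD // step.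
  by move=> y; rewrite mem_rcons inE => /orP[/eqP->|/pZ].
(* Removing the loops leaves at most [size Z] steps of length [3 * e]; the two ends of the walk add
   [2 * e]. *)
move: xkp; case/shortenP: rp => p' rp' up' pp' xkp'.
have sp' : (size p' <= size Z)%N.
  apply: uniq_leq_size; first by case/andP: up'.
  by move=> y /pp' /pZ.
have := path_dist rp'; rewrite -/r => hp.
have hle : (size p')%:R * (e *+ 3) <= (size Z)%:R * (e *+ 3).
  by rewrite ler_wpM2r ?mulrn_wge0 // ler_nat.
have d1 := ler_normc_distD a (x 0%N) (x k).
have d2 := ler_normc_distD (last a p') a (x k).
rewrite (normcBC (last a p')) in d2.
have -> : ((size Z)%:R * 3 + 2) * e = (size Z)%:R * (e *+ 3) + 2 * e.
  by rewrite -mulr_natr; ring.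
lra.
Qed.

(** The existential stands outside the implication so that a total function can be chosen; for an
    empty list its value is arbitrary. *)
Lemma nearest (Z : seq C) x :
  exists y, Z != [::] -> y \in Z /\ forall z, z \in Z -> N (x - y) <= N (x - z).
Proof.
elim: Z => [|a Z [y IH]]; first by exists 0.
have [->|Z0] := eqVneq Z [::].
  by exists a => _; split=> [|z]; rewrite ?mem_head // inE => /eqP->.
have [yZ yle] := IH Z0.
have [ay|ya] := leP (N (x - a)) (N (x - y)).
  exists a => _; split=> [|z]; first exact: mem_head.
  by rewrite inE => /orP[/eqP-> //|/yle]; exact: le_trans.
exists y => _; split=> [|z]; first by rewrite inE yZ orbT.
by rewrite inE => /orP[/eqP->|/yle //]; exact: ltW.
Qed.

Lemma ler_dist_min (y h T : R) : 0 <= h ->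
  `|Num.min y T - Num.min (y + h) T| <= h.
Proof.
by move=> h0; case: (leP y T) => a; case: (leP (y + h) T) => b;
  rewrite distrC ger0_norm; lra.
Qed.

(** The threshold in [roots_in_disc], with [M] the bound on the number of zeros: a value below it
    forces a zero within [e]. *)
Definition tolerance (rho c : R) M e := c * (e / (2 * rho)) ^+ M.

(** The factor [2] allows for two times at distance [d] being rounded to a grid of mesh at most
    [d]. *)
Definition modulus (f : C -> R -> C) (T rho eta d : R) :=
  forall s t, 0 <= s <= T -> 0 <= t <= T -> `|s - t| <= 2 * d ->
    forall u, N u <= rho -> N (f u s - f u t) < eta.

(** A possibly discontinuous approximate selection. In the last clause, at every scale [e] resolved
    by the mesh, the modulus of continuity does not depend on [h]. *)
Definition grid_selection (f : C -> R -> C) (T rho c : R) M h (g : R -> C) :=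
  [/\ forall t, 0 <= t <= T -> N (g t) <= rho,
      forall t, 0 <= t <= T ->
        exists t', [/\ 0 <= t' <= T, `|t - t'| <= h & N (f (g t) t') <= h],
      forall e, 0 < e <= 2 * rho -> h < tolerance rho c M e / 3 -> N (g 0) <= e &
      forall e d, 0 < e <= 2 * rho ->
        modulus f T rho (tolerance rho c M e / 3) d -> h <= d ->
        h < tolerance rho c M e / 3 ->
        forall s t, 0 <= s <= T -> 0 <= t <= T -> `|s - t| <= d ->
        N (g s - g t) <= (M%:R * 3 + 2) * e].

(** At grid times [f] is replaced by polynomials with error at most [h]. A walk goes from the
    current zero to the nearest zero at the next grid time, and [g] is constant between grid
    times. *)
Lemma grid_selection_exists (f : C -> R -> C) (T rho c K h d1 : R) :
  let M := Num.truncn (2 * (K + 1) / (c / 2)) in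
  let tol := tolerance rho (c / 2) M in
  0 <= T -> 0 < rho -> 0 < c ->
  (forall t, 0 <= t <= T -> forall eta, 0 < eta ->
    exists q : {poly C}, forall u, N u <= 4 * rho -> N (q.[u] - f u t) <= eta) ->
  (forall t, 0 <= t <= T -> forall u, N u = rho -> c <= N (f u t)) ->
  (forall t, 0 <= t <= T -> forall u, N u <= 4 * rho -> N (f u t) <= K) ->
  f 0 0 = 0 ->
  0 < h -> h <= 1 -> h <= c / 2 -> h < tol (2 * rho) / 3 ->
  h <= d1 -> modulus f T rho (tol (2 * rho) / 3) d1 ->
  exists g, grid_selection f T rho (c / 2) M h g.
Proof.
move=> M tol T0 rho0 c0 approx circ bound f00 h0 h1 hc htol hd1 md1.
pose tm j := Num.min (j%:R * h) T.
have tmT j : 0 <= tm j <= T.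
  by rewrite le_min T0 mulr_ge0 ?(ltW h0) //= ge_min lexx orbT.
have tmS j : `|tm j - tm j.+1| <= h.
  by rewrite /tm -natr1 mulrDl mul1r ler_dist_min // ltW.
have [q hq] := choice (fun j => approx _ (tmT j) _ h0).
have r4 u : N u <= rho -> N u <= 4 * rho.
  by move=> ?; lra.
have qcirc j u : N u = rho -> c / 2 <= N (q j).[u].
  move=> Nu; have := circ _ (tmT j) _ Nu; have := hq j u; rewrite normcBC.
  have -> : N u <= 4 * rho by rewrite Nu; lra.
  by have := ler_normc_dist (f u (tm j)) (q j).[u]; move=> ? /(_ isT); lra.
have qK j u : N u <= 4 * rho -> N (q j).[u] <= K + 1.
  move=> Nu; have := bound _ (tmT j) _ Nu; have := hq j u Nu.
  have := ler_normc_dist (q j).[u] (f u (tm j)); lra.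
have c2 : 0 < c / 2 by rewrite divr_gt0.
have [Z hZ] := choice (fun j => roots_in_disc rho0 c2 (qcirc j) (qK j)).
(* An approximate zero at time [tm i] lies near a zero of [q j]: its residue, the change of [f]
   between the times and the error of [q j] are each below a third of the tolerance. *)
have key e i j y : 0 < e <= 2 * rho -> h < tol e / 3 -> N y <= rho ->
    N (f y (tm i)) <= h -> N (f y (tm i) - f y (tm j)) < tol e / 3 ->
    exists2 z, z \in Z j & N (y - z) <= e.
  move=> he hte yrho hy hij; have [_ _ hn] := hZ j; apply: hn => //.
  rewrite -/M -[X in _ < X]/(tol e).
  have := hq j y (r4 _ yrho); have := ler_normc_dist (q j).[y] (f y (tm j)).
  have := ler_normc_dist (f y (tm j)) (f y (tm i)).
  rewrite (normcBC (f y (tm j)) (f y (tm i))); lra.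
have Zf j y : y \in Z j -> N y <= rho /\ N (f y (tm j)) <= h.
  have [_ hZj _] := hZ j => /hZj[/rootP qy yrho]; split=> //.
  by have := hq j y (r4 _ yrho); rewrite qy sub0r normc_opp.
have [near hnear] := choice (fun p => nearest p.1 p.2).
pose x := nat_rect (fun _ => C) (near (Z 0%N, 0)) (fun j y => near (Z j.+1, y)).
have r2 : 0 < 2 * rho <= 2 * rho by rewrite lexx andbT mulr_gt0.
have near_le e j y : (exists2 z, z \in Z j & N (y - z) <= e) ->
    near (Z j, y) \in Z j /\ N (y - near (Z j, y)) <= e.
  move=> [z zZ hz]; have [|a b] := hnear (Z j, y); first by move: zZ; case: (Z j).
  by split=> //; exact: le_trans (b _ zZ) hz.
have tm0 : tm 0%N = 0 by rewrite /tm mul0r min_l.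
have start e : 0 < e <= 2 * rho -> h < tol e / 3 ->
    exists2 z, z \in Z 0%N & N (0 - z) <= e.
  move=> he hte; apply: (@key e 0%N) => //; rewrite ?Normc.normc0 ?(ltW rho0) //.
    by rewrite tm0 f00 Normc.normc0 ltW.
  by rewrite subrr Normc.normc0; exact: lt_trans hte.
have step e d j : 0 < e <= 2 * rho -> modulus f T rho (tol e / 3) d ->
    h <= d -> h < tol e / 3 ->
    x j \in Z j -> x j.+1 \in Z j.+1 /\ N (x j - x j.+1) <= e.
  move=> he me hd hte /Zf[xrho fx]; apply: near_le; apply: (@key e j) => //.
  by apply: me => //; apply: le_trans (tmS j) _; lra.
(* The coarsest scale [2 * rho] serves to show that no list of zeros is empty. *)
have xZ j : x j \in Z j.
  elim: j => [|j IH]; first by have [] := near_le _ _ _ (start _ r2 htol).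
  by have [] := step _ _ _ r2 md1 hd1 htol IH.
pose idx (t : R) := Num.truncn (t / h).
have idxP t : 0 <= t -> (idx t)%:R * h <= t < (idx t)%:R * h + h.
  move=> t0; have /truncn_itv : 0 <= t / h by rewrite divr_ge0 // ltW.
  by rewrite ler_pdivlMr // ltr_pdivrMr // -natr1 mulrDl mul1r.
have tm_idx t : 0 <= t <= T -> tm (idx t) = (idx t)%:R * h.
  move=> /andP[t0 tT]; have /andP[a _] := idxP _ t0.
  by rewrite /tm min_l // (le_trans a).
exists (fun t => x (idx t)); split.
- by move=> t _; have [] := Zf _ _ (xZ (idx t)).
- move=> t tT; exists (tm (idx t)); split => //; last by have [] := Zf _ _ (xZ (idx t)).
  rewrite tm_idx //; case/andP: tT => /idxP/andP[a b] _.
  by rewrite ger0_norm; lra.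
- move=> e he hte; rewrite /idx mul0r truncn0 /=.
  by have [_] := near_le _ _ _ (start _ he hte); rewrite sub0r normc_opp.
- move=> e d he me hd hte s t.
  wlog st : s t / s <= t => [wl sT tT dst|].
    have [st|/ltW ts] := leP s t; first exact: wl.
    by rewrite normcBC; apply: wl; rewrite // distrC.
  move=> sT tT; rewrite distrC ger0_norm ?subr_ge0 // => dst.
  have ij : (idx s <= idx t)%N.
    by apply: le_truncn; rewrite ler_pM2r ?invr_gt0.
  (* Between the two times every position of the walk is almost a zero at the earlier grid time,
     hence close to the single finite set [Z (idx s)]. *)
  have := @chain_dist (Z (idx s)) (fun l => x (idx s + l)%N) e (idx t - idx s)%N.
  rewrite addn0 subnKC // => ch.
  have [sZ _ _] := hZ (idx s).
  apply: le_trans (ch _ _ _) _.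
  + by apply: ltW; case/andP: he.
  + move=> l lk; have [xr fx] := Zf _ _ (xZ (idx s + l)%N).
    apply: (@key e (idx s + l)%N) => //; apply: me => //.
    have /andP[a _] := idxP _ (proj1 (andP tT)).
    have /andP[_ b] := idxP _ (proj1 (andP sT)).
    have il : (idx s + l)%:R * h <= (idx t)%:R * h.
      by rewrite ler_pM2r // ler_nat -leq_subRL.
    have ile : (idx s)%:R * h <= (idx s + l)%:R * h.
      by rewrite ler_pM2r // ler_nat leq_addr.
    have -> : tm (idx s + l)%N = (idx s + l)%:R * h.
      by rewrite /tm min_l //; case/andP: tT => _; lra.
    by rewrite tm_idx // ger0_norm; lra.
  + move=> l _; rewrite addnS.
    by have [] := step _ _ _ he me hd hte (xZ (idx s + l)%N).
  + rewrite ler_wpM2r // ?(ltW (proj1 (andP he))) // lerD2r ler_wpM2r //.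
    by rewrite ler_nat.
Qed.

(** Compactness of the segment gives a cluster point, and along an ultrafilter a cluster point is a
    limit. *)
Lemma ultra_lim_real (U : set_system R) (F : R -> R) (B : R) : UltraFilter U ->
  U [set h | `|F h| <= B] ->
  exists l, forall e, 0 < e -> U [set h | `|F h - l| < e].
Proof.
move=> UU UB; have FB : (F @ U) [set` `[- B, B]].
  by apply: (@filterS _ U _ _ _ _ UB) => h /= hB; rewrite in_itv /= -ler_norml.
have [l [_ cl]] := @segment_compact R (- B) B (F @ U) _ FB.
exists l => e e0.
have [//|Uc] := in_ultra_setVsetC [set h | `|F h - l| < e] UU.
have [|y [/= yb ybl]] := cl (~` ball l e) (ball l e) _ (nbhsx_ballx l e e0).
  by apply: (@filterS _ U _ _ _ _ Uc) => h /= nh bl; apply: nh; rewrite distrC.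
by case: (yb ybl).
Qed.

Lemma ultra_lim (U : set_system R) (F : R -> C) (B : R) : UltraFilter U ->
  U [set h | N (F h) <= B] ->
  exists l, forall e, 0 < e -> U [set h | N (F h - l) <= e].
Proof.
move=> UU UB.
have [a ha] : exists l, forall e, 0 < e -> U [set h | `|complex.Re (F h) - l| < e].
  apply: (@ultra_lim_real _ _ B) => //.
  by apply: filterS UB => h /=; apply: le_trans; exact: normc_Re.
have [b hb] : exists l, forall e, 0 < e -> U [set h | `|complex.Im (F h) - l| < e].
  apply: (@ultra_lim_real _ _ B) => //.
  by apply: filterS UB => h /=; apply: le_trans; exact: normc_Im.
exists (a +i* b) => e e0; have e2 : 0 < e / 2 by rewrite divr_gt0.
apply: filterS2 (ha _ e2) (hb _ e2) => h /= h1 h2.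
apply: le_trans (normc_le_ReIm _) _; rewrite -/(F h).
by case: (F h) h1 h2 => x y /=; lra.
Qed.

(* The grid selections of mesh [h] share a modulus of continuity, so that their
   limit along an ultrafilter finer than [h --> 0+] is a continuous selection. *)
Theorem continuous_zero_selection (f : C -> R -> C) (T rho c K : R) :
  0 <= T -> 0 < rho -> 0 < c ->
  (forall t, 0 <= t <= T -> forall eta, 0 < eta ->
    exists q : {poly C}, forall u, N u <= 4 * rho -> N (q.[u] - f u t) <= eta) ->
  (forall t, 0 <= t <= T -> forall u, N u = rho -> c <= N (f u t)) ->
  (forall t, 0 <= t <= T -> forall u, N u <= 4 * rho -> N (f u t) <= K) ->
  (forall eta, 0 < eta -> exists2 d, 0 < d & modulus f T rho eta d) ->
  (forall t, 0 <= t <= T -> forall eta, 0 < eta -> exists2 d, 0 < d &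
     forall u v, N u <= rho -> N v <= rho -> N (u - v) <= d ->
       N (f u t - f v t) <= eta) ->
  f 0 0 = 0 ->
  exists g : R -> C,
   [/\ g 0 = 0,
       forall t, 0 <= t <= T -> f (g t) t = 0 &
       forall e, 0 < e -> exists2 d, 0 < d & forall s t,
         0 <= s <= T -> 0 <= t <= T -> `|s - t| <= d -> N (g s - g t) <= e].
Proof.
move=> T0 rho0 c0 approx circ bound ucont_t cont_u f00.
set M := Num.truncn (2 * (K + 1) / (c / 2)).
pose tol := tolerance rho (c / 2) M.
have tol0 e : 0 < e -> 0 < tol e / 3.
  by move=> e0; rewrite divr_gt0 // mulr_gt0 ?exprn_gt0 ?divr_gt0 ?mulr_gt0.
have rho20 : 0 < 2 * rho by rewrite mulr_gt0.
have [d1 d10 md1] := ucont_t _ (tol0 _ rho20).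
pose small h := 0 < h /\ [/\ h <= 1, h <= c / 2, h < tol (2 * rho) / 3 & h <= d1].
(* Total in [h] for the sake of [choice]; the dummy value occurs only for meshes neglected by the
   ultrafilter below. *)
have grids h : exists g, small h -> grid_selection f T rho (c / 2) M h g.
  have [[h0 [h1 h2 h3 h4]]|nh] := pselect (small h); last by exists (fun=> 0).
  have [g hg] := grid_selection_exists T0 rho0 c0 approx circ bound f00 h0 h1 h2 h3 h4 md1.
  by exists g.
have [G hG] := choice grids.
have [U [UU FU]] := ultraFilterLemma (at_right_proper_filter (0 : R)).
have UP : ProperFilter U := @ultra_proper _ _ UU.
have UF : Filter U := @filter_filter _ _ UP.
have UI P Q : U P -> U Q -> U (P `&` Q) by exact: filterI.
have Uex P Q : U P -> U Q -> exists h, P h /\ Q h.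
  by move=> UPh UQ; exact: filter_ex (UI _ _ UPh UQ).
have Ule e : 0 < e -> U [set h | h < e].
  by move=> e0; apply: FU; exact: nbhs_right_lt.
have Usel : U [set h | grid_selection f T rho (c / 2) M h (G h)].
  have Upos : U [set h | 0 < h] by apply: FU; exact: nbhs_right_gt.
  have c2 : 0 < c / 2 by rewrite divr_gt0.
  have Usmall : U ([set h | h < 1] `&` [set h | h < c / 2]
      `&` ([set h | h < tol (2 * rho) / 3] `&` ([set h | h < d1] `&` [set h | 0 < h]))).
    by do ![apply: filterI | exact: Upos | apply: Ule => //]; exact: tol0.
  apply: filterS Usmall => h /= [[h1 h2] [h3 [h4 h5]]]; apply: hG; split => //.
  by split => //; exact: ltW.
have lims t : exists l, 0 <= t <= T ->
    forall e, 0 < e -> U [set h | N (G h t - l) <= e].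
  case: (boolP (0 <= t <= T)) => [tT|_]; last by exists 0.
  have [l hl] : exists l, forall e, 0 < e -> U [set h | N (G h t - l) <= e].
    apply: (@ultra_lim _ _ rho) => //.
    by apply: filterS Usel => h [+ _ _ _] => /(_ _ tT).
  by exists l.
have [g hg] := choice lims.
have TT : (0 : R) <= 0 <= T by rewrite lexx.
have grho t : 0 <= t <= T -> N (g t) <= rho.
  move=> tT; apply/ler_addgt0Pr => e e0.
  have [h [/= [+ _ _ _] he]] := Uex _ _ Usel (hg _ tT _ e0).
  move=> /(_ _ tT); have := ler_normc_dist (g t) (G h t).
  rewrite normcBC; lra.
exists g; split.
- apply/eqP; rewrite -normc_eq0 eq_le normc_ge0 andbT.
  apply/ler_addgt0Pr => e e0; rewrite add0r.
  pose e' := Num.min (e / 2) (2 * rho).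
  have e'0 : 0 < e' by rewrite lt_min divr_gt0.
  have e'r : 0 < e' <= 2 * rho by rewrite e'0 ge_min lexx orbT.
  have e'e : e' <= e / 2 by rewrite ge_min lexx.
  have [h [/= [_ _ + _] [ht he]]] :=
    Uex _ _ Usel (UI _ _ (Ule _ (tol0 _ e'0)) (hg _ TT _ e'0)).
  move=> /(_ _ e'r ht); have := ler_normc_dist (g 0) (G h 0).
  rewrite normcBC; lra.
- move=> t tT; apply/eqP; rewrite -normc_eq0 eq_le normc_ge0 andbT.
  apply/ler_addgt0Pr => e e0; rewrite add0r.
  have e3 : 0 < e / 3 by rewrite divr_gt0.
  (* Three errors of [e / 3]: replacing [g t] by [G h t], moving the time to the grid, and the
     residue there. *)
  have [d d0 md] := ucont_t _ e3; have [d' d'0 hd'] := cont_u _ tT _ e3.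
  have [h [/= [Grho Gz _ _] [[hd he] hgt]]] :=
    Uex _ _ Usel (UI _ _ (UI _ _ (Ule _ d0) (Ule _ e3)) (hg _ tT _ d'0)).
  have [t' [t'T tt' ft']] := Gz _ tT.
  have h1 := hd' _ _ (grho _ tT) (Grho _ tT).
  rewrite normcBC in hgt; have {h1} := h1 hgt.
  have h2 : N (f (G h t) t - f (G h t) t') < e / 3.
    by apply: md => //; [lra|exact: Grho].
  have := ler_normc_dist (f (g t) t) (f (G h t) t).
  have := ler_normc_dist (f (G h t) t) (f (G h t) t'); lra.
- move=> e e0; pose A : R := M%:R * 3 + 2.
  have A0 : 0 < A by rewrite ltr_wpDl // mulr_ge0.
  (* The common modulus of the grid selections at scale [e'] costs [A * e' <= e / 3]; the other two
     thirds are the distances to the limits at [s] and [t]. *)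
  pose e' := Num.min (e / 3 / A) (2 * rho).
  have e'0 : 0 < e' by rewrite lt_min !divr_gt0.
  have e'r : 0 < e' <= 2 * rho by rewrite e'0 ge_min lexx orbT.
  have e'e : A * e' <= e / 3 by rewrite mulrC -ler_pdivlMr // ge_min lexx.
  have e3 : 0 < e / 3 by rewrite divr_gt0.
  have [d d0 md] := ucont_t _ (tol0 _ e'0); exists d => // s t sT tT st.
  have [h [/= [_ _ _ Gm] [[hd ht] [hs ht']]]] := Uex _ _ Usel
    (UI _ _ (UI _ _ (Ule _ d0) (Ule _ (tol0 _ e'0)))
             (UI _ _ (hg _ sT _ e3) (hg _ tT _ e3))).
  have := Gm _ _ e'r md (ltW hd) ht _ _ sT tT st; rewrite -/A => h1.
  have := ler_normc_distD (G h s) (g s) (g t).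
  have := ler_normc_distD (G h t) (G h s) (g t); move: h1 e'e.
  rewrite (normcBC (g s) (G h s)); lra.
Qed.

End ContinuousSelection.

(** * The complex exponential and its polynomial approximation *)

Section ComplexExponential.
Local Open Scope complex_scope.
Context {R : realType}.
Notation C := R[i].
Implicit Types (z w : C) (x y : R).

Lemma cexpD z w : cexp (z + w) = cexp z * cexp w.
Proof.
case: z w => [a b] [c d]; rewrite /cexp /= expRD cosD sinD.
by apply/eqP; rewrite eq_complex /=; apply/andP; split; apply/eqP; ring.
Qed.

Lemma cexp0 : cexp 0 = 1 :> C.
Proof. by rewrite /cexp /= expR0 cos0 sin0 mul1r. Qed.

Lemma cexpMn z n : cexp (z *+ n) = cexp z ^+ n.
Proof.
by elim: n => [|n IH]; rewrite ?mulr0n ?cexp0 // mulrS exprS cexpD IH.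
Qed.

Lemma normc_cexp z : N (cexp z) = expR (complex.Re z).
Proof.
by rewrite Normc.normcM normc_real ger0_norm ?expR_ge0 //= cos2Dsin2 sqrtr1 mulr1.
Qed.

Lemma cexp_neq0 z : cexp z != 0.
Proof. by rewrite -normc_gt0 normc_cexp expR_gt0. Qed.

Lemma normc_cexp_le z : N (cexp z) <= expR (N z).
Proof.
by rewrite normc_cexp ler_expR; apply: le_trans (normc_Re z); exact: ler_norm.
Qed.

Lemma sin_le_id x : `|sin x| <= `|x|.
Proof.
wlog x0 : x / 0 <= x => [wl|].
  have [/wl //|/ltW x0] := leP 0 x.
  by rewrite -(normrN x) -(normrN (sin x)) -sinN; apply: wl; rewrite oppr_ge0.
have [c _] : exists2 c, c \in `[0, x] & sin x - sin 0 = cos c * (x - 0).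
  apply: (@MVT_segment R sin cos) => //.
  by apply: continuous_subspaceT; exact: continuous_sin.
rewrite sin0 !subr0 => ->; rewrite normrM ler_piMl // ler_norml.
by rewrite cos_geN1 cos_le1.
Qed.

Lemma cos_sub1_le x : `|cos x - 1| <= x ^+ 2.
Proof.
wlog x0 : x / 0 <= x => [wl|].
  have [/wl //|/ltW x0] := leP 0 x.
  by rewrite -sqrrN -cosN; apply: wl; rewrite oppr_ge0.
have [c] : exists2 c, c \in `[0, x] & cos x - cos 0 = - sin c * (x - 0).
  apply: (@MVT_segment R cos (fun y => - sin y)) => //.
  by apply: continuous_subspaceT; exact: continuous_cos.
rewrite in_itv /= => /andP[c0 cx].
rewrite cos0 !subr0 => ->; rewrite normrM normrN (ger0_norm x0) expr2.
apply: ler_wpM2r => //; apply: le_trans (sin_le_id _) _.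
by rewrite ger0_norm.
Qed.

Lemma sin_sub_id_le x : `|x| <= 1 -> `|sin x - x| <= x ^+ 2.
Proof.
wlog x0 : x / 0 <= x => [wl|].
  have [/wl //|/ltW x0] := leP 0 x.
  rewrite -sqrrN -(normrN x) => x1.
  have -> : sin x - x = - (sin (- x) - - x) by rewrite sinN; ring.
  by rewrite normrN; apply: wl; rewrite ?oppr_ge0.
rewrite ger0_norm // => x1.
have [c] : exists2 c, c \in `[0, x] & sin x - sin 0 = cos c * (x - 0).
  apply: (@MVT_segment R sin cos) => //.
  by apply: continuous_subspaceT; exact: continuous_sin.
rewrite in_itv /= => /andP[c0 cx].
rewrite sin0 !subr0 => ->.
have -> : cos c * x - x = (cos c - 1) * x by ring.
rewrite normrM (ger0_norm x0) expr2; apply: ler_wpM2r => //.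
apply: le_trans (cos_sub1_le _) _; rewrite expr2.
by apply: (le_trans _ cx); rewrite ler_piMl //; lra.
Qed.

(** For the upper bound, [1 - x <= expR (- x)] gives [(1 - x) * expR x <= 1], while
    [(1 - x) * (1 + x + 2 * x ^+ 2) >= 1] for [x <= 1 / 2]. *)
Lemma expR_sub1_sub_id x : `|x| <= 1 / 2 -> `|expR x - 1 - x| <= 2 * x ^+ 2.
Proof.
rewrite ler_norml => /andP[xl xu]; have h1 := expR_ge1Dx x.
have h2 := expR_ge1Dx (- x); rewrite expRN in h2.
have e0 := expR_gt0 x.
have h3 : (1 - x) * expR x <= 1.
  by have := ler_wpM2r (ltW e0) h2; rewrite mulVf ?gt_eqF.
rewrite ger0_norm; last lra.
have h4 : 0 <= (1 - 2 * x) * x ^+ 2 by rewrite mulr_ge0 ?sqr_ge0 //; lra.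
have h5 : (1 - x) * (1 + x + 2 * x ^+ 2) >= 1.
  have -> : (1 - x) * (1 + x + 2 * x ^+ 2) = 1 + (1 - 2 * x) * x ^+ 2 by ring.
  by rewrite lerDl.
have : (1 - x) * expR x <= (1 - x) * (1 + x + 2 * x ^+ 2) by exact: le_trans h5.
rewrite ler_pM2l; lra.
Qed.

Lemma normc_sqr z : N z ^+ 2 = complex.Re z ^+ 2 + complex.Im z ^+ 2.
Proof. by case: z => a b /=; rewrite sqr_sqrtr // addr_ge0 ?sqr_ge0. Qed.

Lemma cexp_second_order z : N z <= 1 / 2 -> N (cexp z - 1 - z) <= 4 * N z ^+ 2.
Proof.
move=> zh; rewrite normc_sqr.
have xh := le_trans (normc_Re z) zh; have yh := le_trans (normc_Im z) zh.
apply: le_trans (normc_le_ReIm _) _.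
case: z xh yh {zh} => x y /= xh yh; rewrite !mul0r !subr0 addr0.
have hx := expR_sub1_sub_id xh.
have hc := cos_sub1_le y; have hs := sin_sub_id_le (le_trans yh _).
have {hs} hs : `|sin y - y| <= y ^+ 2 by apply: hs; lra.
have hs1 := sin_le_id y.
have x2 : x ^+ 2 <= 1 / 2 * `|x|.
  by rewrite -real_normK ?num_real // expr2 ler_wpM2r.
have e2 : expR x <= 2.
  by have := ler_norm x; have := ler_norm (expR x - 1 - x); lra.
have ex1 : `|expR x - 1| <= 2 * `|x|.
  have -> : expR x - 1 = (expR x - 1 - x) + x by ring.
  apply: le_trans (ler_normD _ _) _; lra.
have re : `|expR x * cos y - 1 - x| <= 2 * x ^+ 2 + 2 * y ^+ 2.
  have -> : expR x * cos y - 1 - x = (expR x - 1 - x) + expR x * (cos y - 1) by ring.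
  apply: le_trans (ler_normD _ _) _; apply: lerD => //.
  rewrite normrM (ger0_norm (expR_ge0 _)); apply: ler_pM => //; exact: expR_ge0.
have im : `|expR x * sin y - y| <= x ^+ 2 + 2 * y ^+ 2.
  have -> : expR x * sin y - y = (expR x - 1) * sin y + (sin y - y) by ring.
  apply: le_trans (ler_normD _ _) _.
  have : `|(expR x - 1) * sin y| <= 2 * `|x| * `|y| by rewrite normrM; exact: ler_pM.
  have := sqr_ge0 (`|x| - `|y|); rewrite sqrrB !real_normK ?num_real //.
  rewrite -mulr_natr; lra.
have := sqr_ge0 x; lra.
Qed.

(** The removable singularity is filled in, so that the increment of the exponential can be divided
    by the blow-up parameter even at [0]. *)
Definition cexp_quot z : C := if z == 0 then 1 else (cexp z - 1) / z.

Lemma cexp_quotE z : cexp z = 1 + z * cexp_quot z.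
Proof.
rewrite /cexp_quot; case: eqVneq => [->|z0]; first by rewrite cexp0 mul0r addr0.
by rewrite mulrCA divff // mulr1 addrC subrK.
Qed.

(** A difference of [n]-th powers: the bases [cexp (z / n)] and [1 + z / n] differ by a second-order
    term, and the cofactor is a sum of [n] terms bounded by [expR (N z)]. *)
Lemma cexp_euler z n : (0 < n)%N -> N z / n%:R <= 1 / 2 ->
  N (cexp z - (1 + z / n%:R) ^+ n) <= 4 * N z ^+ 2 * expR (N z) / n%:R.
Proof.
move=> n0 zn; have n0R : 0 < n%:R :> R by rewrite ltr0n.
have n0C : n%:R != 0 :> C by rewrite pnatr_eq0 -lt0n.
have Nn : N n%:R = n%:R :> R.
  by rewrite -(rmorph_nat (real_complex R)) normc_real ger0_norm.
set w := z / n%:R.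
have Nw : N w = N z / n%:R by rewrite Normc.normcM Normc.normcV Nn.
have -> : cexp z = cexp w ^+ n by rewrite -cexpMn -mulr_natr divfK.
rewrite subrXX Normc.normcM.
have h1 : N (cexp w - (1 + w)) <= 4 * (N z / n%:R) ^+ 2.
  by rewrite opprD addrA -Nw; apply: cexp_second_order; rewrite Nw.
have h2 : N (\sum_(i < n) cexp w ^+ (n.-1 - i) * (1 + w) ^+ i) <= n%:R * expR (N z).
  apply: le_trans (normc_sum _ _) _.
  have -> : n%:R * expR (N z) = \sum_(i < n) expR (N z).
    by rewrite sumr_const card_ord mulr_natl.
  apply: ler_sum => i _; rewrite Normc.normcM !normcX.
  have -> : expR (N z) = expR (N w) ^+ n.
    by rewrite -expRM_natl Nw mulrCA divff ?mulr1 // gt_eqF.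
  have e1 : 1 <= expR (N w) by rewrite -expR0 ler_expR normc_ge0.
  have w1 : N (1 + w) <= expR (N w).
    apply: le_trans (ler_normcD _ _) _; rewrite Normc.normc1; exact: expR_ge1Dx.
  apply: (@le_trans _ _ (expR (N w) ^+ (n.-1 - i) * expR (N w) ^+ i)).
    by apply: ler_pM; rewrite ?exprn_ge0 ?normc_ge0 ?lerXn2r ?nnegrE
      ?normc_ge0 ?expR_ge0 ?normc_cexp_le.
  rewrite -exprD subnK; last by rewrite -ltnS prednK.
  by apply: ler_weXn2l => //; exact: leq_pred.
apply: le_trans (ler_pM (normc_ge0 _) (normc_ge0 _) h1 h2) _.
rewrite le_eqVlt; apply/orP; left; apply/eqP.
by field; rewrite gt_eqF.
Qed.

(** The polynomial [((1 + z / n) ^+ n - 1) / z], as a geometric sum that makes sense at [0]. *)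
Definition euler_quot n z : C := n%:R^-1 * \sum_(k < n) (1 + z / n%:R) ^+ k.

Lemma euler_quotE n z : z * euler_quot n z = (1 + z / n%:R) ^+ n - 1.
Proof.
have -> a : (1 + a) ^+ n - 1 = a * \sum_(k < n) (1 + a) ^+ k.
  by rewrite subrX1 [X in X * _]addrAC subrr add0r.
by rewrite /euler_quot mulrA.
Qed.

(** The error in [cexp_euler] carries [N z ^+ 2]: one factor [N z] cancels and the bound stays
    uniform near [z = 0]. *)
Lemma cexp_quot_approx B eta : 0 <= B -> 0 < eta -> exists n, forall z,
  N z <= B -> N (cexp_quot z - euler_quot n z) <= eta.
Proof.
move=> B0 eta0.
pose L := 4 * B * expR B / eta + 2 * B.
have L0 : 0 <= L by rewrite addr_ge0 ?divr_ge0 ?mulr_ge0 ?expR_ge0 // ltW.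
exists (Num.bound L).+1 => z zB; set n := (Num.bound L).+1.
have n0R : 0 < n%:R :> R by rewrite ltr0n.
have Ln : L <= n%:R.
  by apply: ltW; apply: lt_le_trans (archi_boundP L0) _; rewrite ler_nat.
have h1 : 4 * B * expR B <= eta * n%:R.
  rewrite -ler_pdivrMl // mulrC; apply: le_trans Ln.
  by rewrite lerDl mulr_ge0.
have [->|z0] := eqVneq z 0.
  rewrite /cexp_quot eqxx /euler_quot.
  under eq_bigr do rewrite mul0r addr0 expr1n.
  rewrite sumr_const card_ord mulVf ?pnatr_eq0 // subrr Normc.normc0; exact: ltW.
have Nz : 0 < N z by rewrite normc_gt0.
rewrite -(ler_pM2l Nz) -Normc.normcM mulrBr euler_quotE //.
have -> : z * cexp_quot z = cexp z - 1 by rewrite cexp_quotE; ring.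
have -> a : cexp z - 1 - (a - 1) = cexp z - a by ring.
have zn : N z / n%:R <= 1 / 2.
  rewrite ler_pdivrMr //.
  have : 0 <= 4 * B * expR B / eta by rewrite divr_ge0 ?mulr_ge0 ?expR_ge0 // ltW.
  by move: Ln; rewrite /L; lra.
apply: le_trans (cexp_euler _ zn) _ => //.
rewrite ler_pdivrMr // expr2 !mulrA (mulrC 4) -!mulrA ler_pM2l //.
apply: le_trans h1; rewrite mulrA.
by apply: ler_pM; rewrite ?expR_ge0 ?ler_expR ?mulr_ge0 ?normc_ge0 ?ler_pM2l.
Qed.

End ComplexExponential.

(** * Uniform limits of polynomials in a complex and a real variable *)

Section UniformLimits.
Local Open Scope complex_scope.
Context {R : realType}.
Notation C := R[i].
Implicit Types (f : C -> R -> C).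

(** This class is closed under sums and products, contains the blown-up exponential, and yields the
    approximations and moduli required by [continuous_zero_selection]. *)
Definition bipoly_limit f := forall eta, 0 < eta -> exists2 g, bipoly g &
  forall s t, N s <= 1 -> `|t| <= 1 -> N (f s t - g s t%:C) <= eta.

Lemma normc_real_le1 (t : R) : `|t| <= 1 -> N t%:C <= 1.
Proof. by rewrite normc_real. Qed.

Lemma bipoly_limit_bipoly g : bipoly g -> bipoly_limit (fun s t => g s t%:C).
Proof.
move=> bg eta eta0; exists g => // s t _ _; rewrite subrr Normc.normc0; exact: ltW.
Qed.

Lemma bipoly_limit_bounded f : bipoly_limit f -> exists2 K, 0 < K &
  forall s t, N s <= 1 -> `|t| <= 1 -> N (f s t) <= K.
Proof.
move=> /(_ _ ltr01)[g bg hg]; have [K K0 hK] := bipoly_bounded 1 bg.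
exists (K + 1); first by rewrite addr_gt0.
move=> s t s1 t1; have := hg _ _ s1 t1; have := hK _ _ s1 (normc_real_le1 t1).
by have := ler_normc_dist (f s t) (g s t%:C); lra.
Qed.

Lemma bipoly_limit_add f g : bipoly_limit f -> bipoly_limit g ->
  bipoly_limit (fun s t => f s t + g s t).
Proof.
move=> lf lg eta eta0; have e2 : 0 < eta / 2 by rewrite divr_gt0.
have [p bp hp] := lf _ e2; have [q bq hq] := lg _ e2.
exists (fun x y => p x y + q x y); first exact: bipoly_add.
move=> s t s1 t1; rewrite opprD addrACA; apply: le_trans (ler_normcD _ _) _.
by have := hp _ _ s1 t1; have := hq _ _ s1 t1; lra.
Qed.

Lemma bipoly_limit_mul f g : bipoly_limit f -> bipoly_limit g ->
  bipoly_limit (fun s t => f s t * g s t).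
Proof.
move=> lf lg; have [F F0 hF] := bipoly_limit_bounded lf.
have [G G0 hG] := bipoly_limit_bounded lg.
move=> eta eta0; pose e := Num.min 1 (eta / (F + (G + 1))).
have S0 : 0 < F + (G + 1) by rewrite !addr_gt0.
have e0 : 0 < e by rewrite lt_min ltr01 divr_gt0.
have e1 : e <= 1 by rewrite ge_min lexx.
have eS : F * e + (G + 1) * e <= eta.
  by rewrite -mulrDl mulrC -ler_pdivlMr // ge_min lexx orbT.
have [p bp hp] := lf _ e0; have [q bq hq] := lg _ e0.
exists (fun x y => p x y * q x y); first exact: bipoly_mul.
move=> s t s1 t1; set a := f s t; set b := g s t.
have -> : a * b - p s t%:C * q s t%:C =
  a * (b - q s t%:C) + (a - p s t%:C) * q s t%:C by ring.
apply: le_trans (ler_normcD _ _) _; rewrite !Normc.normcM.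
have qb : N (q s t%:C) <= G + 1.
  have := ler_normc_dist (q s t%:C) b; rewrite normcBC.
  by have := hq _ _ s1 t1; have := hG _ _ s1 t1; rewrite -/b; lra.
apply: le_trans eS; rewrite [X in _ <= _ + X]mulrC.
by apply: lerD; apply: ler_pM; rewrite ?normc_ge0 ?hF ?hG ?hp ?hq.
Qed.

Lemma bipoly_limit_const (c : C) : bipoly_limit (fun _ _ => c).
Proof. exact: (bipoly_limit_bipoly (bipoly_const c)). Qed.

Lemma bipoly_limit_exp f n : bipoly_limit f -> bipoly_limit (fun s t => f s t ^+ n).
Proof.
move=> lf; elim: n => [|n IH].
  by under eq_fun do under eq_fun do rewrite expr0; exact: bipoly_limit_const.
by under eq_fun do under eq_fun do rewrite exprS; exact: bipoly_limit_mul.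
Qed.

Lemma bipoly_limit_sum I (r : seq I) (F : I -> C -> R -> C) :
  (forall i, bipoly_limit (F i)) ->
  bipoly_limit (fun s t => \sum_(i <- r) F i s t).
Proof.
move=> lF; elim: r => [|i r IH].
  by under eq_fun do under eq_fun do rewrite big_nil; exact: bipoly_limit_const.
by under eq_fun do under eq_fun do rewrite big_cons; exact: bipoly_limit_add.
Qed.

Lemma bipoly_limit_cexp_quot z : bipoly z ->
  bipoly_limit (fun s t => cexp_quot (z s t%:C)).
Proof.
move=> bz eta eta0; have [B B0 hB] := bipoly_bounded 1 bz.
have [n hn] := cexp_quot_approx (ltW B0) eta0.
exists (fun x y => euler_quot n (z x y)).
  apply: bipoly_mul; first exact: bipoly_const.
  apply: bipoly_sum => i; apply: bipoly_exp.
  apply: bipoly_add; first exact: bipoly_const.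
  by apply: bipoly_mul => //; exact: bipoly_const.
by move=> s t s1 t1; apply: hn; apply: hB => //; exact: normc_real_le1.
Qed.

Lemma bipoly_limit_poly f t eta : bipoly_limit f -> `|t| <= 1 -> 0 < eta ->
  exists q : {poly C}, forall s, N s <= 1 -> N (q.[s] - f s t) <= eta.
Proof.
move=> lf t1 /lf[g bg hg]; have [q hq] := bipoly_polyl t%:C bg.
by exists q => s s1; rewrite -hq normcBC; exact: hg.
Qed.

Lemma bipoly_limit_ucont f eta : bipoly_limit f -> 0 < eta ->
  exists2 d, 0 < d & forall s t s' t',
    N s <= 1 -> `|t| <= 1 -> N s' <= 1 -> `|t'| <= 1 ->
    N (s - s') <= d -> `|t - t'| <= d -> N (f s t - f s' t') <= eta.
Proof.
move=> lf eta0; have e3 : 0 < eta / 3 by rewrite divr_gt0.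
have [g bg hg] := lf _ e3; have [K K0 hK] := bipoly_lipschitz 1 bg.
exists (eta / 3 / (2 * K)); first by rewrite divr_gt0 ?mulr_gt0.
move=> s t s' t' s1 t1 s1' t1' ss tt.
have h1 := hg _ _ s1 t1; have h2 := hg _ _ s1' t1'.
have h3 := hK _ _ _ _ s1 (normc_real_le1 t1) s1' (normc_real_le1 t1').
rewrite -rmorphB normc_real in h3.
have h4 : K * (N (s - s') + `|t - t'|) <= eta / 3.
  have -> : eta / 3 = K * (eta / 3 / (2 * K) + eta / 3 / (2 * K)).
    by field; rewrite gt_eqF.
  by rewrite ler_pM2l // lerD.
have := ler_normc_distD (g s t%:C) (f s t) (f s' t').
have := ler_normc_distD (g s' t'%:C) (g s t%:C) (f s' t').
rewrite (normcBC (g s' t'%:C) (f s' t')); lra.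
Qed.

End UniformLimits.

(** * Blow-up of a bivariate polynomial and its tangent cone *)

Section BlowUp.
Local Open Scope complex_scope.
Context {R : realType}.
Notation C := R[i].
Implicit Types (Q : {poly {poly C}}).

(* [Q (x u) (x v) / x ^ r]: for [r] the order of [Q] at the origin, the
   subtraction is truncated only in terms with a zero coefficient. *)
Definition blow_up Q r (u v x : C) : C :=
  \sum_(j < size Q) \sum_(i < size Q`_j) Q`_j`_i * u ^+ i * v ^+ j * x ^+ (i + j - r).

Definition vanishing_order Q r :=
  (forall i j, (i + j < r)%N -> Q`_j`_i = 0) /\
  exists i j, (i + j)%N = r /\ Q`_j`_i != 0.

Lemma vanishing_order_exists Q : Q != 0 -> exists r, vanishing_order Q r.
Proof.
move=> Q0; pose P r := `[< exists i j, (i + j)%N = r /\ Q`_j`_i != 0 >].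
have exP : exists r, P r.
  exists ((size (lead_coef Q)).-1 + (size Q).-1)%N; apply/asboolP.
  by exists (size (lead_coef Q)).-1, (size Q).-1; rewrite -!lead_coefE !lead_coef_eq0.
case: (ex_minnP exP) => r /asboolP[i [j [ij Qij]]] minr.
exists r; split; last by exists i, j.
move=> k l kl; apply/eqP/negPn/negP => Qkl.
have /minr : P (k + l)%N by apply/asboolP; exists k, l.
by rewrite leqNgt kl.
Qed.

Lemma blow_upE Q r u v x : vanishing_order Q r ->
  Q.[(x * v)%:P].[x * u] = x ^+ r * blow_up Q r u v x.
Proof.
move=> [low _]; rewrite (horner_coef Q) horner_sum mulr_sumr.
apply: eq_bigr => j _; rewrite hornerM -polyC_exp hornerC horner_coef.
rewrite mulr_suml mulr_sumr; apply: eq_bigr => i _.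
have [ij|rij] := ltnP (i + j) r; first by rewrite low // !mul0r mulr0.
rewrite !exprMn -[in RHS](mulrC (x ^+ _)) [RHS]mulrA -exprD subnKC // exprD; ring.
Qed.

(** At [x = 0] only the terms of degree exactly [r] survive, since [0 ^+ 0 = 1]: this is the tangent
    cone, a form of degree [r]. *)
Lemma blow_up_homogeneous Q r k u v : vanishing_order Q r ->
  blow_up Q r (k * u) (k * v) 0 = k ^+ r * blow_up Q r u v 0.
Proof.
move=> [low _]; rewrite mulr_sumr; apply: eq_bigr => j _.
rewrite mulr_sumr; apply: eq_bigr => i _.
have [ij|rij] := ltnP (i + j) r; first by rewrite low // !mul0r mulr0.
rewrite expr0n; have [ijr|] := eqVneq (i + j - r)%N 0%N; last by rewrite !mulr0.
have <- : (i + j)%N = r by apply/eqP; rewrite eqn_leq -subn_eq0 ijr.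
by rewrite !exprMn exprD; ring.
Qed.

Lemma bipoly_blow_up Q r (u v x : C -> C -> C) :
  bipoly u -> bipoly v -> bipoly x ->
  bipoly (fun s t => blow_up Q r (u s t) (v s t) (x s t)).
Proof.
move=> bu bv bx; apply: bipoly_sum => j; apply: bipoly_sum => i.
by do ![apply: bipoly_mul]; try exact: bipoly_const; exact: bipoly_exp.
Qed.

Lemma bipoly_limit_blow_up Q r (u v x : C -> R -> C) :
  bipoly_limit u -> bipoly_limit v -> bipoly_limit x ->
  bipoly_limit (fun s t => blow_up Q r (u s t) (v s t) (x s t)).
Proof.
move=> bu bv bx; apply: bipoly_limit_sum => j; apply: bipoly_limit_sum => i.
by do ![apply: bipoly_limit_mul]; try exact: bipoly_limit_const;
  exact: bipoly_limit_exp.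
Qed.

Lemma nonroot (p : {poly C}) : p != 0 -> exists x, p.[x] != 0.
Proof.
move=> p0; have [rho [c [/andP[rho0 _] c0 hc]]] := isolating_circle p0 ltr01.
exists rho%:C; rewrite -normc_gt0; apply: lt_le_trans c0 (hc _ _).
by rewrite normc_real gtr0_norm.
Qed.

(* A line that misses the origin is not contained in the tangent cone. *)
Lemma blow_up_line_neq0 Q r b d : vanishing_order Q r -> b != 0 ->
  exists u, blow_up Q r u (b + d * u) 0 != 0.
Proof.
move=> ord b0; have [low [i0 [j0 [ij0 Q0]]]] := ord.
pose a j := \sum_(i < size Q`_j) Q`_j`_i * 0 ^+ (i + j - r) : C.
pose p := \poly_(j < size Q) a j.
(* For [j = j0], smaller [i] have a zero coefficient and larger [i] carry a positive power of [0];
   only [i0] is left. *)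
have aE : a j0 = (Q`_j0)`_i0.
  have si : (i0 < size (Q`_j0)%R)%N.
    by rewrite ltnNge; apply: contra Q0 => /(nth_default 0) ->.
  rewrite /a (bigD1 (Ordinal si)) //= -ij0 subnn expr0 mulr1 big1 ?addr0 //.
  move=> i; rewrite -val_eqE /= => ii0.
  have [ij|ij] := ltnP (i + j0) r; first by rewrite low ?mul0r.
  rewrite expr0n subnDr subn_eq0 leqNgt.
  have -> : (i0 < i)%N by rewrite ltn_neqAle eq_sym ii0 -(leq_add2r j0) ij0.
  by rewrite mulr0.
have pE s : p.[s] = blow_up Q r 1 s 0.
  rewrite horner_poly; apply: eq_bigr => j _; rewrite mulr_suml.
  by apply: eq_bigr => i _; rewrite expr1n mulr1 mulrAC.
have p0 : p != 0.
  apply/eqP => p0; have := congr1 (fun q : {poly C} => q`_j0) p0.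
  rewrite coef_poly coef0 ltnNge aE; case: leqP => [sj|_] /=.
    by move: Q0; rewrite (nth_default 0 sj) coef0 eqxx.
  by move/eqP: Q0.
(* For a slope [s != d] off the cone, the line [v = b + d * u] meets [v = s * u] at
   [u = b / (s - d)], and homogeneity keeps the form nonzero there. *)
have [s] : exists s, (p * ('X - d%:P)).[s] != 0.
  by apply: nonroot; rewrite mulf_neq0 // polyXsubC_eq0.
rewrite hornerM hornerXsubC mulf_eq0 negb_or pE => /andP[ps sd].
exists (b / (s - d)).
have -> : b + d * (b / (s - d)) = b / (s - d) * s by field.
rewrite -[X in blow_up _ _ X _]mulr1 blow_up_homogeneous //.
by rewrite mulf_neq0 // expf_neq0 // mulf_neq0 // invr_eq0.
Qed.

End BlowUp.

(** * The curve of zeros issuing from a crossing point *)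

Section CrossingCurve.
Local Open Scope complex_scope.
Context {R : realType}.
Notation C := R[i].
Implicit Types (Q : {poly {poly C}}).

(** Dividing by [h ^+ r] leaves a zero of the blow-up at [(e, v, h)], a point close to [(e, y1, 0)];
    the Lipschitz bound passes to the limit. *)
Lemma tangent_direction Q r (e y1 : C) : vanishing_order Q r ->
  (forall eps, 0 < eps -> exists h v,
     [/\ h != 0, `|h| < eps, N (v - y1) < eps & Q.[(h%:C * v)%:P].[h%:C * e] = 0]) ->
  blow_up Q r e y1 0 = 0.
Proof.
move=> ord near0; apply/eqP/negPn/negP; rewrite -normc_gt0 => m0.
have bg : bipoly (fun s t => blow_up Q r e s t).
  apply: bipoly_blow_up; [exact: bipoly_const|exact: bipoly_fst|exact: bipoly_snd].
have [K K0 lK] := bipoly_lipschitz (N y1 + 1) bg.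
set m := N _ in m0; have y10 := normc_ge0 y1.
have [|h [v [h0 he ve Q0]]] := near0 (Num.min 1 (m / (2 * K))).
  by rewrite lt_min ltr01 divr_gt0 ?mulr_gt0.
move: he ve; rewrite !lt_min => /andP[h1 hm] /andP[v1 vm].
have bz : blow_up Q r e v h%:C = 0.
  move/eqP: Q0; rewrite (blow_upE _ _ _ ord) mulf_eq0 expf_eq0.
  by rewrite -(rmorph0 (real_complex R)) (inj_eq (@complexI R)) (negbTE h0) andbF => /eqP.
have := lK v h%:C y1 0; rewrite bz sub0r normc_opp -/m subr0 normc_real Normc.normc0.
move=> /(_ _ _ _ _); have := ler_normc_dist v y1.
move=> d1 h2; have {h2} := h2 _ _ _ _.
have -> : N v <= N y1 + 1 by lra.
have -> : `|h| <= N y1 + 1 by lra.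
have -> : N y1 <= N y1 + 1 by lra.
have -> : 0 <= N y1 + 1 by lra.
move=> /(_ isT isT isT isT); apply/negP; rewrite -ltNge.
have -> : m = K * (m / (2 * K) + m / (2 * K)) by field; rewrite gt_eqF.
by rewrite ltr_pM2l // ltrD.
Qed.

(** Selections for [t >= 0] and for [t <= 0] are built separately around the isolated zero [0] of
    [q0] and glued at [t = 0], where both vanish. *)
Lemma zero_curve (H : C -> R -> C) (q0 : {poly C}) :
  bipoly_limit H -> H 0 0 = 0 -> q0 != 0 -> (forall s, H s 0 = q0.[s]) ->
  exists u T, [/\ 0 < T, u 0 = 0,
    forall t, `|t| <= T -> H (u t) t = 0 &
    forall eps, 0 < eps -> exists2 d, 0 < d & forall s t,
      `|s| <= T -> `|t| <= T -> `|s - t| <= d -> N (u s - u t) <= eps].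
Proof.
move=> lH H00 q0N0 hq0.
(* A radius below [1 / 4] puts the disc of radius [4 * rho] inside the unit disc, where [H] is
   controlled. *)
have [|rho [c [/andP[rho0 rho4] c0 hc]]] := isolating_circle q0N0 (e := 1 / 4).
  by rewrite divr_gt0.
have c20 : 0 < c / 2 by rewrite divr_gt0.
have [d d0 hd] := bipoly_limit_ucont lH c20.
pose T := Num.min 1 d.
have T0 : 0 < T by rewrite lt_min ltr01.
have T1 : T <= 1 by rewrite ge_min lexx.
have Td : T <= d by rewrite ge_min lexx orbT.
have s1 s : N s <= 4 * rho -> N s <= 1 by move=> ?; lra.
have r1 s : N s <= rho -> N s <= 1 by move=> ?; lra.
have [K K0 hK] := bipoly_limit_bounded lH.
have side (sg : R) : `|sg| = 1 -> exists g : R -> C,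
   [/\ g 0 = 0, forall t, 0 <= t <= T -> H (g t) (sg * t) = 0 &
       forall eps, 0 < eps -> exists2 d, 0 < d & forall s t,
         0 <= s <= T -> 0 <= t <= T -> `|s - t| <= d -> N (g s - g t) <= eps].
  move=> sg1.
  have tT t : 0 <= t <= T -> `|sg * t| <= T.
    by move=> /andP[t0 tT]; rewrite normrM sg1 mul1r ger0_norm.
  have t1 t : 0 <= t <= T -> `|sg * t| <= 1 by move=> /tT; lra.
  apply: (@continuous_zero_selection _ (fun s t => H s (sg * t)) T rho (c / 2) K) => //.
  - exact: ltW.
  - move=> t /t1 ht eta eta0; have [q hq] := bipoly_limit_poly lH ht eta0.
    by exists q => s /s1; exact: hq.
  - move=> t ht s Ns; have := hc _ Ns; rewrite -hq0 => h1.
    have := hd s 0 s (sg * t); rewrite subrr Normc.normc0 sub0r normrN normr0.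
    move=> /(_ (r1 _ _) ler01 (r1 _ _) (t1 _ ht) (ltW d0)).
    rewrite Ns lexx => /(_ isT isT (le_trans (tT _ ht) Td)).
    have := ler_normc_dist (H s 0) (H s (sg * t)); lra.
  - by move=> t /t1 ht s /s1 hs; exact: hK.
  - move=> eta eta0; have e2 : 0 < eta / 2 by rewrite divr_gt0.
    have [d' d'0 hd'] := bipoly_limit_ucont lH e2.
    exists (d' / 2); first by rewrite divr_gt0.
    move=> s t hs ht st u hu; apply: (@le_lt_trans _ _ (eta / 2)); last lra.
    apply: hd'; rewrite ?t1 ?r1 ?subrr ?Normc.normc0 ?(ltW d'0) //.
    rewrite -mulrBr normrM sg1 mul1r; lra.
  - move=> t /t1 ht eta eta0; have [d' d'0 hd'] := bipoly_limit_ucont lH eta0.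
    exists d' => // s s' hs hs' ss'.
    by apply: hd'; rewrite ?r1 ?subrr ?normr0 ?(ltW d'0).
  - by rewrite mulr0.
have [g1 [g10 g1z g1c]] := side 1 (normr1 _).
have [g2 [g20 g2z g2c]] := side (-1) (normrN1 _).
pose u t := if 0 <= t then g1 t else g2 (- t).
exists u, T; split => //.
- by rewrite /u lexx g10.
- move=> t; rewrite ler_norml => /andP[tl tu]; rewrite /u.
  have [t0|t0] := leP 0 t; first by rewrite -{2}(mul1r t) g1z ?t0.
  by have := g2z (- t); rewrite mulN1r opprK; apply; rewrite oppr_ge0 (ltW t0) lerNl.
- move=> eps eps0; have e2 : 0 < eps / 2 by rewrite divr_gt0.
  have [d1 d10 h1] := g1c _ e2; have [d2 d20 h2] := g2c _ e2.
  exists (Num.min d1 d2); first by rewrite lt_min d10.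
  have TT : (0 : R) <= 0 <= T by rewrite lexx ltW.
  move=> s t; wlog st : s t / s <= t => [wl hs ht hst|].
    have [st|/ltW ts] := leP s t; first exact: wl.
    by rewrite normcBC; apply: wl; rewrite // distrC.
  rewrite !(ler_norml _ T) (le_min _ d1 d2) => /andP[sl su] /andP[tl tu].
  move=> /andP[st1 st2]; rewrite /u.
  case: (leP 0 s) => s0; case: (leP 0 t) => t0.
  + by apply: le_trans (h1 s t _ _ _) _; rewrite ?s0 ?t0 //; lra.
  + by have := lt_le_trans t0 s0; rewrite ltNge st.
  + have st0 : `|s - t| = t - s by rewrite distrC ger0_norm ?subr_ge0.
    rewrite st0 in st1 st2.
    have k1 : N (g1 t) <= eps / 2.
      have := h1 t 0; rewrite g10 !subr0 t0 tu (ger0_norm t0).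
      by apply => //; lra.
    have k2 : N (g2 (- s)) <= eps / 2.
      have := h2 (- s) 0; rewrite g20 !subr0 normrN (ltr0_norm s0).
      apply => //; last lra.
      by rewrite oppr_ge0 (ltW s0) lerNl.
    apply: le_trans (ler_normcB _ _) _; lra.
  + apply: le_trans (h2 (- s) (- t) _ _ _) _; last lra.
    * by rewrite oppr_ge0 (ltW s0) lerNl.
    * by rewrite oppr_ge0 (ltW t0) lerNl.
    * by rewrite -opprD normrN.
Qed.

(** With [lambda = lam0 + t * (b + s)] and delay [tau + t], the increments of [lambda] and of the
    exponential are multiples of [t], so the equation becomes [t ^+ r * H s t = 0]. The equation on
    [k] says that [k] times the cone direction [(e, y1)] lies on the line obtained at [t = 0]. *)
Lemma rescaled_crossing_curve Q (lam0 y0 y1 k e : C) (tau : R) :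
  Q != 0 -> y0 = cexp (- (lam0 * tau%:C)) -> lam0 != 0 ->
  (forall eps, 0 < eps -> exists h v,
     [/\ h != 0, `|h| < eps, N (v - y1) < eps & Q.[(h%:C * v)%:P].[h%:C * e] = 0]) ->
  k * y1 = - (y0 * (lam0 + k * e * tau%:C)) ->
  exists u T, [/\ 0 < T, u 0 = k * e,
    forall t, `|t| <= T ->
      Q.[(cexp (- ((lam0 + t%:C * u t) * (tau + t)%:C)) - y0)%:P].[t%:C * u t] = 0 &
    forall eps, 0 < eps -> exists2 d, 0 < d & forall s t,
      `|s| <= T -> `|t| <= T -> `|s - t| <= d -> N (u s - u t) <= eps].
Proof.
move=> Q0 y0E lam00 near0 kE; have [r ord] := vanishing_order_exists Q0.
have cone0 := tangent_direction ord near0.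
have y00 : y0 != 0 by rewrite y0E cexp_neq0.
set b := k * e.
(* The exponent is exactly [- (lam0 * tau) + t * zeta], and [v] is the increment of the exponential
   divided by [t]. *)
pose zeta (s t : C) := - (lam0 + (b + s) * tau%:C + t * (b + s)).
pose v (s : C) (t : R) := y0 * zeta s t%:C * cexp_quot (t%:C * zeta s t%:C).
pose H (s : C) (t : R) := blow_up Q r (b + s) (v s t) t%:C.
have bs : bipoly (fun s _ : C => b + s).
  by apply: bipoly_add; [exact: bipoly_const|exact: bipoly_fst].
have bz : bipoly zeta.
  have -> : zeta = (fun s t => -1 * (lam0 + (b + s) * tau%:C + t * (b + s))).
    by apply/funext => s; apply/funext => t; rewrite mulN1r.
  apply: bipoly_mul; first exact: bipoly_const.
  apply: bipoly_add; last by apply: bipoly_mul => //; exact: bipoly_snd.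
  apply: bipoly_add; first exact: bipoly_const.
  by apply: bipoly_mul => //; exact: bipoly_const.
have lH : bipoly_limit H.
  apply: bipoly_limit_blow_up.
  - exact: bipoly_limit_bipoly bs.
  - apply: bipoly_limit_mul.
      by apply: (bipoly_limit_bipoly (g := fun s t => y0 * zeta s t));
        apply: bipoly_mul => //; exact: bipoly_const.
    apply: (bipoly_limit_cexp_quot (z := fun s t => t * zeta s t)).
    by apply: bipoly_mul => //; exact: bipoly_snd.
  - exact: bipoly_limit_bipoly bipoly_snd.
have HQ s t : H s t = 0 ->
    Q.[(cexp (- ((lam0 + t%:C * (b + s)) * (tau + t)%:C)) - y0)%:P].[t%:C * (b + s)] = 0.
  move=> H0; have -> : cexp (- ((lam0 + t%:C * (b + s)) * (tau + t)%:C)) - y0 =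
      t%:C * v s t.
    have -> : - ((lam0 + t%:C * (b + s)) * (tau + t)%:C) =
        - (lam0 * tau%:C) + t%:C * zeta s t%:C by rewrite rmorphD /zeta; ring.
    rewrite cexpD -y0E cexp_quotE /v; ring.
  by rewrite (blow_upE _ _ _ ord) -/(H s t) H0 mulr0.
have H0E s : H s 0 = blow_up Q r (b + s) (- (y0 * lam0) + - (y0 * tau%:C) * (b + s)) 0.
  rewrite /H /v /cexp_quot rmorph0 mul0r eqxx mulr1 /zeta; congr blow_up; ring.
have H00 : H 0 0 = 0.
  rewrite H0E addr0.
  have -> : - (y0 * lam0) + - (y0 * tau%:C) * b = k * y1 by rewrite kE /b; ring.
  by rewrite /b blow_up_homogeneous // cone0 mulr0.
have [q0 hq0] : exists q0 : {poly C}, forall s, H s 0 = q0.[s].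
  have [|q0 hq0] := @bipoly_polyl _ (fun s _ =>
      blow_up Q r (b + s) (- (y0 * lam0) + - (y0 * tau%:C) * (b + s)) 0) 0.
    apply: bipoly_blow_up => //; last exact: bipoly_const.
    apply: bipoly_add; first exact: bipoly_const.
    by apply: bipoly_mul => //; exact: bipoly_const.
  by exists q0 => s; rewrite H0E.
have q0N0 : q0 != 0.
  (* The line misses the origin because [y0 * lam0] is nonzero. *)
  have [|u hu] := blow_up_line_neq0 (b := - (y0 * lam0)) (- (y0 * tau%:C)) ord.
    by rewrite oppr_eq0 mulf_neq0.
  apply: contraNneq hu => q00.
  by have := H0E (u - b); rewrite hq0 q00 horner0 addrC subrK => <-.
have [u [T [T0 u0 uz uc]]] := zero_curve lH H00 q0N0 hq0.
exists (fun t => b + u t), T; split => //; first by rewrite u0 addr0.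
- by move=> t /uz /HQ.
- move=> eps /uc[d d0 hd]; exists d => // s t hs ht st.
  have -> : b + u s - (b + u t) = u s - u t by ring.
  exact: hd.
Qed.

End CrossingCurve.

(** * The characteristic determinant as a bivariate polynomial *)

Section CharacteristicPolynomial.
Local Open Scope complex_scope.
Context {R : realType}.
Notation C := R[i].

Lemma horner_char_poly n (A : 'M[C]_n) z : (char_poly A).[z] = \det (z%:M - A).
Proof.
rewrite -[LHS]/(horner_eval z _) -det_map_mx; congr (\det _).
apply/matrixP => i j; rewrite !mxE /= /horner_eval hornerD hornerN hornerC.
by rewrite hornerMn hornerX.
Qed.

(** Nonzero because [y = - y0] removes [B] and leaves the monic characteristic polynomial of [A]. *)
Lemma char_poly2 n (A B : 'M[C]_n) (l0 y0 : C) : exists2 Q : {poly {poly C}},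
  Q != 0 & forall x y, Q.[y%:P].[x] = \det ((l0 + x)%:M - A - (y0 + y) *: B).
Proof.
pose M : 'M[{poly {poly C}}]_n := \matrix_(i, j)
  ((l0%:P + 'X)%:P *+ (i == j) - (A i j)%:P%:P - (y0%:P%:P + 'X) * (B i j)%:P%:P).
have ME x y : (\det M).[y%:P].[x] = \det ((l0 + x)%:M - A - (y0 + y) *: B).
  rewrite -[LHS]/(horner_eval x (horner_eval y%:P _)) -!det_map_mx.
  congr (\det _); apply/matrixP => i j; rewrite !mxE /= /horner_eval.
  by rewrite !(hornerD, hornerN, hornerM, hornerC, hornerMn, hornerX).
exists (\det M) => //; apply/eqP => M0.
have [z] := nonroot (monic_neq0 (char_poly_monic A)).
rewrite horner_char_poly => /eqP; apply.
have := ME (z - l0) (- y0); rewrite M0 !horner0 subrr scale0r subr0.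
by rewrite [l0 + _]addrC subrK => <-.
Qed.

End CharacteristicPolynomial.

(** * Continuity and derivatives in a real parameter *)

Section RealParameter.
Local Open Scope complex_scope.
Context {R : realType}.
Notation C := R[i].

Lemma near_distP (P : R -> Prop) (t : R) :
  (\forall s \near t, P s) <-> exists2 d, 0 < d & forall s, `|s - t| < d -> P s.
Proof.
split=> [/nbhs_ballP[d /= d0 hd]|[d d0 hd]].
  by exists d => // s st; apply: hd; rewrite /ball /= distrC.
by apply/nbhs_ballP; exists d => //= s; rewrite /ball /= distrC; exact: hd.
Qed.

Lemma dnear_distP (P : R -> Prop) (t : R) :
  (\forall s \near t^', P s) <->
  exists2 d, 0 < d & forall s, s != t -> `|s - t| < d -> P s.
Proof.
apply: (iff_trans (near_distP (fun s => s != t -> P s) t)).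
by split=> -[d d0 hd]; exists d => // s; auto.
Qed.

Lemma ccontinuous_distP (f : R -> C) t : ccontinuous_at f t <->
  forall e, 0 < e -> exists2 d, 0 < d & forall s, `|s - t| < d -> N (f s - f t) <= e.
Proof.
split=> [[/cvgrPdist_le cr /cvgrPdist_le ci] e e0|h].
  have e2 : 0 < e / 2 by rewrite divr_gt0.
  have /near_distP[d1 d10 h1] := cr _ e2; have /near_distP[d2 d20 h2] := ci _ e2.
  exists (Num.min d1 d2); first by rewrite lt_min d10.
  move=> s; rewrite lt_min => /andP[/h1 k1 /h2 k2].
  apply: le_trans (normc_le_ReIm _) _.
  move: k1 k2; case: (f s) => a b; case: (f t) => a' b' /=.
  rewrite (distrC a) (distrC b); lra.
split; apply/cvgrPdist_le => e /h[d d0 hd]; apply/near_distP; exists d => // s /hd;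
  rewrite normcBC; apply: le_trans.
  by apply: le_trans (normc_Re _); case: (f s) => a b; case: (f t).
by apply: le_trans (normc_Im _); case: (f s) => a b; case: (f t).
Qed.

Lemma is_derive_distP (f : R -> R) a l :
  (forall e, 0 < e -> exists2 d, 0 < d & forall h, h != 0 -> `|h| < d ->
     `|(f (a + h) - f a) / h - l| <= e) -> is_derive a 1 f l.
Proof.
move=> hf; have cv : h^-1 *: ((f \o shift a) (h *: 1) - f a) @[h --> 0^'] --> l.
  apply/cvgrPdist_le => e /hf[d d0 hd]; apply/dnear_distP; exists d => // h h0.
  rewrite subr0 => /(hd _ h0); rewrite distrC; apply: le_trans.
  by rewrite /= [_%:A]mulr1 [h + a]addrC [_ *: _]mulrC.
by apply: DeriveDef; [apply: cvgP cv|apply: cvg_lim cv].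
Qed.

Lemma derivable_dist (f : R -> R) a : derivable f a 1 ->
  forall e, 0 < e -> exists2 d, 0 < d & forall h, h != 0 -> `|h| < d ->
    `|(f (a + h) - f a) / h - derive1 f a| <= e.
Proof.
rewrite derive1E => /cvgrPdist_le cv e /cv/dnear_distP[d d0 hd].
exists d => // h h0 hh; have := hd _ h0; rewrite subr0 => /(_ hh).
by rewrite distrC /= [_%:A]mulr1 [h + a]addrC [_ *: _]mulrC.
Qed.

Lemma ler_prod_dist (u v : C) (a b : R) :
  N (a%:C * u - b%:C * v) <= `|a| * N (u - v) + `|a - b| * N v.
Proof.
have -> : a%:C * u - b%:C * v = a%:C * (u - v) + (a - b)%:C * v.
  by rewrite rmorphB; ring.
by apply: le_trans (ler_normcD _ _) _; rewrite !Normc.normcM !normc_real.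
Qed.

(** The difference quotient of [lam] at [tau] is [u] itself, so its continuity at [0] gives the
    derivative. *)
Lemma rescaled_curve_regular (u : R -> C) (T tau : R) (lam0 : C) :
  let lam t := lam0 + (t - tau)%:C * u (t - tau) in
  0 < T ->
  (forall eps, 0 < eps -> exists2 d, 0 < d & forall s t,
      `|s| <= T -> `|t| <= T -> `|s - t| <= d -> N (u s - u t) <= eps) ->
  (forall t, `|t - tau| < T -> ccontinuous_at lam t) /\
  is_derive tau 1 (fun t => complex.Re (lam t)) (complex.Re (u 0)).
Proof.
move=> lam T0 uc; split=> [t tT|].
  apply/ccontinuous_distP => e e0.
  have e2 : 0 < e / 2 by rewrite divr_gt0.
  have [d d0 hd] := uc _ (divr_gt0 e2 T0).
  pose K := N (u (t - tau)) + 1.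
  have K0 : 0 < K by rewrite ltr_wpDl // normc_ge0.
  have T1 : 0 < T - `|t - tau| by rewrite subr_gt0.
  exists (Num.min d (Num.min (e / 2 / K) (T - `|t - tau|))).
    by rewrite !lt_min d0 divr_gt0.
  move=> s; rewrite !lt_min => /and3P[sd sK sT].
  have stau : `|s - tau| <= T.
    have := ler_distD t s tau; move: sT; clear; lra.
  have -> : lam s - lam t = (s - tau)%:C * u (s - tau) - (t - tau)%:C * u (t - tau).
    by rewrite /lam; ring.
  apply: le_trans (ler_prod_dist _ _ _ _) _.
  have st : s - tau - (t - tau) = s - t by ring.
  rewrite st; have -> : e = e / 2 + e / 2 by field.
  apply: lerD.
    apply: (@le_trans _ _ (T * (e / 2 / T))).
      apply: ler_pM; rewrite ?normr_ge0 ?normc_ge0 //.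
      by apply: hd; rewrite ?st //; exact: ltW.
    by rewrite mulrCA divff ?mulr1 // gt_eqF.
  apply: (@le_trans _ _ (e / 2 / K * K)); last by rewrite divfK // gt_eqF.
  apply: ler_pM; rewrite ?normr_ge0 ?normc_ge0 ?(ltW sK) //.
  by rewrite /K lerDl.
apply: is_derive_distP => e /uc[d d0 hd].
exists (Num.min d T); first by rewrite lt_min d0.
move=> h h0; rewrite lt_min => /andP[hhd hT].
have -> : complex.Re (lam (tau + h)) - complex.Re (lam tau) = h * complex.Re (u h).
  rewrite /lam subrr [tau + h]addrC addrK.
  case: (lam0) (u h) (u 0) => a b [c k] [c' k'] /=; ring.
rewrite mulrC mulKf //.
have -> : complex.Re (u h) - complex.Re (u 0) = complex.Re (u h - u 0).
  by case: (u h) (u 0) => a b [].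
apply: le_trans (normc_Re _) _; apply: hd.
- exact: ltW.
- by rewrite normr0 ltW.
- by rewrite subr0 ltW.
Qed.

(** Removes the square root before differentiation. At [Y w = 0] both sides vanish by the convention
    [ln 0 = 0]. *)
Lemma acs_gamma_lnE (Y : R -> C) w : acs_gamma Y w =
  - (ln (complex.Re (Y w) ^+ 2 + complex.Im (Y w) ^+ 2) / 2).
Proof.
rewrite /acs_gamma -normc_sqr; congr (- _).
have [->|Y0] := eqVneq (N (Y w)) 0; first by rewrite expr0n /= ln0 // mul0r.
have Y0' : 0 < N (Y w) by rewrite lt0r Y0 normc_ge0.
by rewrite lnXn // mulr2n; field.
Qed.

Lemma is_derive_ln_norm (a b : R -> R) (w a' b' : R) :
  is_derive w 1 a a' -> is_derive w 1 b b' -> a w ^+ 2 + b w ^+ 2 = 1 ->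
  is_derive w 1 (fun t => - (ln (a t ^+ 2 + b t ^+ 2) / 2)) (- (a w * a' + b w * b')).
Proof.
move=> da db s1; have dS := is_deriveD (is_deriveM da da) (is_deriveM db db).
have SE : (a * a + b * b) w = 1 by rewrite -s1 !expr2.
have dl : is_derive ((a * a + b * b) w) 1 (@ln R) ((a * a + b * b) w)^-1.
  by apply: is_derive1_ln; rewrite SE.
have dg := is_deriveZ (- 2^-1) (is_derive1_comp dl dS).
have -> : (fun t => - (ln (a t ^+ 2 + b t ^+ 2) / 2)) =
    - 2^-1 \*: (@ln R \o (a * a + b * b)).
  by apply/funext => t; rewrite /= -!expr2 mulrC -mulNr.
apply: is_derive_eq dg _; rewrite SE invr1 /GRing.scale /=.
by field.
Qed.

(** As [N (Y w) = 1], the bracket is the real part of [Y' / Y] at [w]. *)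
Lemma derive1_acs_gamma (Y : R -> C) w : cderivable_at Y w -> N (Y w) = 1 ->
  derive1 (acs_gamma Y) w = - (complex.Re (Y w) * derive1 (fun t => complex.Re (Y t)) w
                             + complex.Im (Y w) * derive1 (fun t => complex.Im (Y t)) w).
Proof.
move=> [/derivableP dr /derivableP di] Y1; rewrite !derive1E.
have -> : acs_gamma Y =
    fun t => - (ln (complex.Re (Y t) ^+ 2 + complex.Im (Y t) ^+ 2) / 2).
  by apply/funext => t; exact: acs_gamma_lnE.
have s1 : complex.Re (Y w) ^+ 2 + complex.Im (Y w) ^+ 2 = 1.
  by rewrite -normc_sqr Y1 expr1n.
by have [_ ->] := is_derive_ln_norm dr di s1.
Qed.

End RealParameter.

(** * The argument, and the delays with a given exponential *)

Section Argument.
Local Open Scope complex_scope.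
Context {R : realType}.
Notation C := R[i].

Lemma carg_polar (y : C) : N y = 1 ->
  y = cos (carg y) +i* sin (carg y).
Proof.
move=> y1; rewrite /carg y1 divr1.
have xI : complex.Re y \in `[(-1), 1] by rewrite in_itv /= -ler_norml -y1 normc_Re.
have xI' := xI; rewrite in_itv /= in xI'.
have sE : sin (acos (complex.Re y)) = `|complex.Im y|.
  rewrite sin_acos // -sqrtr_sqr; congr (Num.sqrt _).
  by rewrite -(expr1n _ 2) -y1 normc_sqr; ring.
have cE := acosK xI.
case: y sE cE {y1 xI xI'} => a b /= sE cE.
case: ifP => b0; first by rewrite cE sE ger0_norm.
by rewrite cosN sinN cE sE ltr0_norm ?opprK // ltNge b0.
Qed.

Lemma cosD2piz (x : R) (k : int) : cos (x + 2 * pi * k%:~R) = cos x.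
Proof.
have nat_case (z : R) n : cos (z + 2 * pi * n%:R) = cos z.
  by rewrite -(periodicn (@cosD2pi R) n z); congr (cos (_ + _)); ring.
case: k => n; first by rewrite -pmulrn nat_case.
by rewrite -(nat_case _ n.+1) NegzE mulrNz; congr cos; rewrite -pmulrn; ring.
Qed.

Lemma sinD2piz (x : R) (k : int) : sin (x + 2 * pi * k%:~R) = sin x.
Proof.
have nat_case (z : R) n : sin (z + 2 * pi * n%:R) = sin z.
  by rewrite -(periodicn (@sinD2pi R) n z); congr (sin (_ + _)); ring.
case: k => n; first by rewrite -pmulrn nat_case.
by rewrite -(nat_case _ n.+1) NegzE mulrNz; congr sin; rewrite -pmulrn; ring.
Qed.

(** Reduce [x] modulo [2 * pi]; cosine is injective on [[0, pi]], and a remainder [d] beyond [pi] is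
    reflected to [2 * pi - d]. *)
Lemma cos_eq1 (x : R) : cos x = 1 -> exists k : int, x = 2 * pi * k%:~R.
Proof.
move=> cx; have p0 := pi_gt0 R; have p2 : 0 < 2 * pi :> R by rewrite mulr_gt0.
pose k := Num.floor (x / (2 * pi)); exists k.
pose d := x + 2 * pi * (- k)%:~R.
have cd : cos d = 1 by rewrite cosD2piz.
have dE : d = x - 2 * pi * k%:~R by rewrite /d mulrNz mulrN.
have /andP[k1 k2] : k%:~R <= x / (2 * pi) < (k + 1)%:~R by exact: floor_itv.
have d0 : 0 <= d by rewrite dE subr_ge0 mulrC -ler_pdivlMr.
have d2 : d < 2 * pi.
  move: k2; rewrite ltr_pdivrMr // intrD mulrDl mul1r dE mulrC; lra.
have inj (y : R) : 0 <= y <= pi -> cos y = 1 -> y = 0.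
  move=> hy cy; apply: cos_inj; rewrite ?cos0 // in_itv /=.
  by rewrite lexx ltW.
have [dpi|pid] := leP d pi.
  by have := inj d; rewrite d0 dpi => /(_ isT cd); rewrite dE => /subr0_eq.
have := inj (2 * pi - d).
have -> : cos (2 * pi - d) = cos d.
  rewrite -(cosN d) -(@cosD2piz (- d) 1); congr cos; ring.
by move=> /(_ _ cd) h; have := h _; lra.
Qed.

Lemma polar_inj (a b : R) : cos a = cos b -> sin a = sin b ->
  exists k : int, a = b + 2 * pi * k%:~R.
Proof.
move=> ca sa; have [|k hk] := @cos_eq1 (a - b).
  by rewrite cosB ca sa -!expr2 cos2Dsin2.
by exists k; rewrite -hk; ring.
Qed.

Lemma cexp_imaginary (x : R) : cexp (0 +i* x) = cos x +i* sin x.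
Proof.
rewrite /cexp /= expR0.
by apply/eqP; rewrite eq_complex /=; apply/andP; split; apply/eqP; ring.
Qed.

Lemma cexp_crossing (w tau : R) : cexp (- ((0 +i* w) * tau%:C)) =
  cos (- (w * tau)) +i* sin (- (w * tau)).
Proof.
rewrite -cexp_imaginary; congr cexp.
by apply/eqP; rewrite eq_complex /=; apply/andP; split; apply/eqP; ring.
Qed.

Lemma cexp_crossing_delay (w : R) (y : C) k : w != 0 -> N y = 1 ->
  cexp (- ((0 +i* w) * (crossing_delay w y k)%:C)) = y.
Proof.
move=> w0 y1; rewrite cexp_crossing /crossing_delay [RHS]carg_polar //.
have -> : - (w * ((- carg y + 2 * pi * k%:~R) / w)) = carg y + 2 * pi * (- k)%:~R.
  by rewrite mulrNz; field.
by rewrite cosD2piz sinD2piz.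
Qed.

Lemma crossing_delay_unique (w tau : R) (y : C) : w != 0 -> N y = 1 ->
  cexp (- ((0 +i* w) * tau%:C)) = y -> exists k, tau = crossing_delay w y k.
Proof.
move=> w0 y1; rewrite cexp_crossing => yE.
have := carg_polar y1; rewrite -{1}yE => -[hc hs].
have [k hk] := polar_inj hc hs; exists (- k).
rewrite /crossing_delay mulrNz mulrN -opprD -hk; field.
exact: w0.
Qed.

End Argument.

(** * From branches of the spectrum to crossings and back *)

Section CrossingsAndSpectrum.
Local Open Scope complex_scope.
Context {R : realType}.
Notation C := R[i].

Lemma difference_quotient_branch (Y : R -> C) w : cderivable_at Y w ->
  let y1 := derive1 (fun t => complex.Re (Y t)) w
            +i* derive1 (fun t => complex.Im (Y t)) w in
  forall e, 0 < e -> exists2 d, 0 < d & forall h, h != 0 -> `|h| < d ->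
    N ((Y (w + h) - Y w) / h%:C - y1) < e.
Proof.
move=> [dr di] y1 e e0; have e3 : 0 < e / 3 by rewrite divr_gt0.
have [d1 d10 h1] := derivable_dist dr e3; have [d2 d20 h2] := derivable_dist di e3.
exists (Num.min d1 d2); first by rewrite lt_min d10.
move=> h h0; rewrite lt_min => /andP[/(h1 _ h0) k1 /(h2 _ h0) k2].
apply: le_lt_trans (normc_le_ReIm _) _; move: k1 k2; rewrite -fmorphV /y1.
case: (Y (w + h)) => a b; case: (Y w) => a' b' /=.
rewrite !mulr0 subr0 add0r => k1 k2; lra.
Qed.

(** The point of the branch at [w + h] is a zero of [Q] with [x = h * i] and [y = h * v], [v] being
    the difference quotient of [Y]; this places [(i, Y'(w))] in the tangent cone. *)
Lemma branch_near (n : nat) (A B : 'M[R]_n) (w : R) (Y : R -> C)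
    (Q : {poly {poly C}}) :
  (forall x y, Q.[y%:P].[x] =
     \det (((0 +i* w) + x)%:M - cmx A - (Y w + y) *: cmx B)) ->
  acs_branch A B w Y -> cderivable_at Y w ->
  forall e, 0 < e -> exists h v, [/\ h != 0, `|h| < e,
    N (v - (derive1 (fun t => complex.Re (Y t)) w
            +i* derive1 (fun t => complex.Im (Y t)) w)) < e &
    Q.[(h%:C * v)%:P].[h%:C * (0 +i* 1)] = 0].
Proof.
move=> QE [/dnear_distP[d d0 hd] _ _] dY e e0.
have [d' d'0 hd'] := difference_quotient_branch dY e0.
pose h := Num.min e (Num.min d d') / 2.
have m0 : 0 < Num.min e (Num.min d d') by rewrite !lt_min e0 d0.
have h0 : 0 < h by rewrite divr_gt0.
have hm : h < Num.min e (Num.min d d') by rewrite /h gtr_pMr // invf_lt1 ?ltr1n.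
move: hm; rewrite !lt_min => /and3P[he hd1 hd2].
have hN0 : h != 0 by rewrite gt_eqF.
exists h, ((Y (w + h) - Y w) / h%:C); split => //.
- by rewrite gtr0_norm.
- by apply: hd'; rewrite // gtr0_norm.
have wh : w + h - w = h by ring.
have [] : acs_root A B (w + h) (Y (w + h)).
  by apply: hd; [rewrite -subr_eq0 wh|rewrite wh gtr0_norm].
have hC0 : h%:C != 0 by rewrite (fmorph_eq0 (real_complex R)).
have lE : (0 +i* w) + h%:C * (0 +i* 1) = 0 +i* (w + h) :> C.
  by apply/eqP; rewrite eq_complex /=; apply/andP; split; apply/eqP; ring.
have yE : Y w + h%:C * ((Y (w + h) - Y w) / h%:C) = Y (w + h).
  by rewrite [h%:C * _]mulrC divfK // addrC subrK.
by rewrite QE lE yE.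
Qed.

Lemma char_poly2_char_fun (n : nat) (A B : 'M[R]_n) l0 y0 (Q : {poly {poly C}}) t l :
  (forall x y, Q.[y%:P].[x] = \det ((l0 + x)%:M - cmx A - (y0 + y) *: cmx B)) ->
  char_fun A B t l = Q.[(cexp (- (l * t%:C)) - y0)%:P].[l - l0].
Proof. by move=> ->; rewrite !(addrC _ (_ - _)) !subrK. Qed.

(** The root curve leaves [i w] with velocity [w / z], where [z = Y'(w) / Y(w) + i tau]. The real
    part of [w / z] is [w / N z ^+ 2] times that of [z], which is minus the derivative of
    [acs_gamma Y] for every [tau]. *)
Lemma crossing_at_delay (n : nat) (A B : 'M[R]_n) (w tau : R) (Y : R -> C) :
  0 < w -> acs_branch A B w Y -> cderivable_at Y w -> N (Y w) = 1 ->
  derive1 (acs_gamma Y) w != 0 -> cexp (- ((0 +i* w) * tau%:C)) = Y w ->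
  exists lam : R -> C, transverse_crossing A B tau w lam /\
    exists2 c, 0 < c &
      derive1 (fun t => complex.Re (lam t)) tau = - (c * derive1 (acs_gamma Y) w).
Proof.
move=> w0 Yb Yd Y1; rewrite derive1_acs_gamma // oppr_eq0.
set Y'r := derive1 (fun t => complex.Re (Y t)) w.
set Y'i := derive1 (fun t => complex.Im (Y t)) w.
set G := _ + _; set l0 := 0 +i* w => G0 /esym yE.
have [Q Q0 QE] := char_poly2 (cmx A) (cmx B) l0 (Y w).
have l00 : l0 != 0 by rewrite eq_complex /= (gt_eqF w0) andbF.
have y0N0 : Y w != 0 by rewrite yE cexp_neq0.
pose y1 := Y'r +i* Y'i.
(* [Y'(w) / Y(w)] has real part [G]. *)
pose z := y1 / Y w + (0 +i* tau).
have zRe : complex.Re z = G.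
  have -> : z = y1 * (complex.Re (Y w) -i* complex.Im (Y w)) + (0 +i* tau).
    rewrite /z; congr (_ * _ + _); apply: (mulfI y0N0); rewrite divff //.
    have := normc_sqr (Y w); rewrite Y1 expr1n; case: (Y w) => a b /= ab.
    by apply/eqP; rewrite eq_complex /=; apply/andP; split; apply/eqP; lra.
  by rewrite /y1 /G /=; ring.
have zN0 : z != 0 by apply: contraNneq G0 => z0; rewrite -zRe z0.
(* The multiple of the cone direction [(i, y1)] that lies on the line, found by solving [kE]. *)
pose k := - (l0 / z).
have kE : k * y1 = - (Y w * (l0 + k * (0 +i* 1) * tau%:C)).
  have itE : (0 +i* 1) * tau%:C = 0 +i* tau.
    by apply/eqP; rewrite eq_complex /=; apply/andP; split; apply/eqP; ring.
  have y1E : y1 = Y w * (z - (0 +i* tau)) by rewrite /z addrK mulrC divfK.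
  rewrite -mulrA itE y1E /k; field; exact: zN0.
have [u [T [T0 u0 uz uc]]] :=
  rescaled_crossing_curve Q0 yE l00 (branch_near QE Yb Yd) kE.
have [lamc lamd] := rescaled_curve_regular tau l0 T0 uc.
pose lam t := l0 + (t - tau)%:C * u (t - tau).
have betaE : complex.Re (u 0) = w / N z ^+ 2 * G.
  have -> : u 0 = w%:C / z.
    rewrite u0 /k mulNr mulrAC -mulNr; congr (_ / _).
    by apply/eqP; rewrite eq_complex /=; apply/andP; split; apply/eqP; ring.
  rewrite -zRe normc_sqr; case: (z) => a b /=; ring.
have dlam : derive1 (fun t => complex.Re (lam t)) tau = w / N z ^+ 2 * G.
  by rewrite derive1E -betaE; exact: derive_val.
have c0 : 0 < w / N z ^+ 2 by rewrite divr_gt0 // exprn_gt0 // normc_gt0.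
exists lam; split; last by exists (w / N z ^+ 2) => //; rewrite mulrN opprK.
split => //.
- by rewrite /lam subrr mul0r addr0.
- apply/near_distP; exists T => // t tT; split; last exact: lamc.
  rewrite (char_poly2_char_fun t _ QE) /lam [l0 + _ - l0]addrC addKr.
  by have := uz (t - tau) (ltW tT); rewrite [tau + _]addrC subrK.
- by rewrite dlam mulf_neq0 // gt_eqF.
Qed.

(** [X] is divided out as long as every coefficient vanishes at [0]. Each division shortens the
    nonzero coefficient of index [j], so the process ends. *)
Lemma extract_fst_power (Q : {poly {poly C}}) : Q != 0 ->
  exists m Q', Q = ('X^m)%:P * Q' /\ exists y, Q'.[y%:P].[0] != 0.
Proof.
move=> Q0; have : (Q`_(size Q).-1) != 0 by rewrite -lead_coefE lead_coef_eq0.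
move: (size Q).-1 => j; move sE : (size Q`_j) => s.
elim: s Q sE {Q0} => [|s IH] Q sE; first by rewrite -size_poly_eq0 sE.
move=> Qj; have [all0|] := pselect (forall i, root (Q`_i) 0); last first.
  move=> /existsNP[i /negP Qi]; exists 0%N, Q; split; first by rewrite expr0 mul1r.
  pose q := \poly_(i < size Q) (Q`_i).[0].
  have [|y hy] := @nonroot _ q.
    apply: contraNneq Qi => q0; have := congr1 (fun p : {poly C} => p`_i) q0.
    rewrite coef_poly coef0; case: ltnP => [_ /rootP //|si _].
    by rewrite nth_default // root0.
  by exists y; move: hy; rewrite horner2E horner_poly.
pose Q1 := \poly_(i < size Q) (Q`_i %/ 'X).
have Q1i i : Q`_i = Q1`_i * 'X.
  rewrite coef_poly; case: ltnP => [_|si]; last by rewrite mul0r nth_default.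
  by rewrite divpK // -['X]subr0 -polyC0 dvdp_XsubCl.
have Q1j : Q1`_j != 0 by apply: contraNneq Qj => h; rewrite Q1i h mul0r.
have [|m [Q' [Q1E hy]]] := IH Q1 _ Q1j.
  by move: sE; rewrite Q1i size_mulX // => -[].
exists m.+1, Q'; split => //.
have -> : Q = 'X%:P * Q1 by apply/polyP => i; rewrite coefCM Q1i mulrC.
by rewrite Q1E mulrA -polyCM -exprS.
Qed.

Lemma least_root (q : {poly C}) : exists y, forall z, root q z ->
  root q y /\ N y <= N z.
Proof.
have [->|q0] := eqVneq q 0.
  by exists 0 => z _; rewrite root0 Normc.normc0 normc_ge0.
have [r qE] := closed_field_poly_normal q; have [y hy] := nearest r 0.
have rootE z : root q z = (z \in r).
  by rewrite qE rootZ ?lead_coef_eq0 // root_prod_XsubC.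
exists y => z; rewrite !rootE => zr; have [|yr yle] := hy.
  by case: (r) zr.
by split=> //; have := yle _ zr; rewrite !sub0r !normc_opp.
Qed.

Lemma horner2_fst (Q : {poly {poly C}}) x : exists q : {poly C},
  forall y, q.[y] = Q.[y%:P].[x].
Proof.
exists (\poly_(i < size Q) (Q`_i).[x]) => y.
by rewrite horner_poly horner2E.
Qed.

(** On a circle free of zeros of [Q(0, .)], the polynomials [Q(x, .)] stay above [c / 2], and they
    are smaller at [0]: [small_value_root] applies. The nonzero value serves to exclude degenerate
    frequencies. *)
Lemma roots_near_origin (Q : {poly {poly C}}) :
  Q.[0%:P].[0] = 0 -> (exists y, Q.[y%:P].[0] != 0) ->
  forall e, 0 < e -> exists2 d, 0 < d & forall x, N x < d ->
    (exists2 y, N y < e & Q.[y%:P].[x] = 0) /\ (exists y, Q.[y%:P].[x] != 0).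
Proof.
move=> Q00 [y0 hy0] e e0; have [q0 hq0] := horner2_fst Q 0.
have q0N0 : q0 != 0 by apply: contraNneq hy0 => q00; rewrite -hq0 q00 horner0.
have [rho [c [/andP[rho0 rhoe] c0 hc]]] := isolating_circle q0N0 e0.
have [K K0 lK] := bipoly_lipschitz (rho + 1) (bipoly_horner2 Q).
exists (Num.min 1 (c / (2 * K))); first by rewrite lt_min ltr01 divr_gt0 ?mulr_gt0.
move=> x; rewrite lt_min => /andP[x1 xK]; have [q hq] := horner2_fst Q x.
have close y : N y <= rho -> N (q.[y] - q0.[y]) < c / 2.
  move=> yrho; rewrite hq hq0; apply: le_lt_trans (lK x y 0 y _ _ _ _) _.
  - by apply: le_trans (ltW x1) _; rewrite lerDr ltW.
  - by apply: le_trans yrho _; rewrite lerDl.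
  - by rewrite Normc.normc0 addr_ge0 // ltW.
  - by apply: le_trans yrho _; rewrite lerDl.
  rewrite subr0 subrr Normc.normc0 addr0.
  have -> : c / 2 = K * (c / (2 * K)) by field; rewrite gt_eqF.
  by rewrite ltr_pM2l.
have circ u : N u = rho -> c / 2 <= N q.[u].
  move=> Nu; have := close u; rewrite Nu lexx => /(_ isT).
  have := hc _ Nu; have := ler_normc_dist q0.[u] q.[u].
  rewrite (normcBC q0.[u]); lra.
have Nrho : N rho%:C = rho by rewrite normc_real gtr0_norm.
split.
  have [||y yrho /rootP qy] := small_value_root rho0 circ (z := 0).
  - by rewrite Normc.normc0 ltW.
  - have := close 0; rewrite Normc.normc0 hq0 Q00 subr0; apply; exact: ltW.
  by exists y; [exact: le_lt_trans rhoe|rewrite -hq].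
exists rho%:C; rewrite -hq -normc_gt0; apply: lt_le_trans (circ _ Nrho).
by rewrite divr_gt0.
Qed.

(** The branch is [y0] plus the root of least modulus of [Q'(i (t - w), .)]. As some root tends to
    [0], so does the least one, which gives continuity at [w]. *)
Lemma acs_branch_of_root (n : nat) (A B : 'M[R]_n) (w : R) (y0 : C) m
    (Q' : {poly {poly C}}) :
  (forall x y, (('X^m)%:P * Q').[y%:P].[x] =
     \det (((0 +i* w) + x)%:M - cmx A - (y0 + y) *: cmx B)) ->
  y0 != 0 -> Q'.[0%:P].[0] = 0 -> (exists y, Q'.[y%:P].[0] != 0) ->
  exists2 Z, acs_branch A B w Z & Z w = y0.
Proof.
move=> QE y00 Q00 Qy.
have QE' x y : x ^+ m * Q'.[y%:P].[x] =
    \det (((0 +i* w) + x)%:M - cmx A - (y0 + y) *: cmx B).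
  by rewrite -QE !hornerM hornerC hornerXn.
have near0 := roots_near_origin Q00 Qy.
have ex t : exists y, forall z, Q'.[z%:P].[0 +i* (t - w)] = 0 ->
    Q'.[y%:P].[0 +i* (t - w)] = 0 /\ N y <= N z.
  have [q hq] := horner2_fst Q' (0 +i* (t - w)); have [y hy] := least_root q.
  by exists y => z; rewrite -!hq => /rootP/hy[/rootP].
have [y hy] := choice ex.
have gen t z : gen_poly A B t z =
    (0 +i* (t - w)) ^+ m * Q'.[(z - y0)%:P].[0 +i* (t - w)].
  have lE : (0 +i* w) + (0 +i* (t - w)) = 0 +i* t :> C.
    by apply/eqP; rewrite eq_complex /=; apply/andP; split; apply/eqP; ring.
  by rewrite QE' lE [y0 + _]addrC subrK.
have subK u : y0 + u - y0 = u by ring.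
have yw : y w = 0.
  have [|_] := hy w 0; first by rewrite subrr.
  by rewrite Normc.normc0 => h; apply/eqP; rewrite -normc_eq0 eq_le h normc_ge0.
have Nt t : N (0 +i* (t - w)) = `|t - w| by rewrite normc_imag.
exists (fun t => y0 + y t); last by rewrite yw addr0.
split; last by rewrite yw addr0.
- apply/dnear_distP; have [|d d0 hd] := near0 (N y0); first by rewrite normc_gt0.
  exists d => // t tw td; have [|[z zy0 Qz] [z' Qz']] := hd (0 +i* (t - w)).
    by rewrite Nt.
  have [Qyt yz] := hy _ _ Qz.
  have x0 : (0 +i* (t - w) : C) != 0 by rewrite eq_complex /= eqxx subr_eq0.
  have gen0 : gen_poly A B t (y0 + y t) = 0.
    by rewrite gen subK Qyt mulr0.
  split => //.
    (* At a degenerate [t] the generating polynomial would be constant, hence [0] as at its root;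
       but it is nonzero at [y0 + z']. *)
    move=> deg; have := gen t (y0 + z'); rewrite deg -(deg (y0 + y t)) gen0.
    move/esym/eqP; rewrite mulf_eq0 expf_eq0 (negbTE x0) andbF /=.
    by rewrite subK (negbTE Qz').
  apply/eqP => h; have : N (y0 + y t) = 0 by rewrite h Normc.normc0.
  have := ler_normc_dist y0 (- y t); rewrite opprK normc_opp; lra.
- apply/ccontinuous_distP => e e0; have [d d0 hd] := near0 _ e0.
  exists d => // t td; have [|[z ze Qz] _] := hd (0 +i* (t - w)); first by rewrite Nt.
  have [_ yz] := hy _ _ Qz.
  have -> : y0 + y t - (y0 + y w) = y t by rewrite yw; ring.
  by apply: le_trans yz _; exact: ltW.
Qed.

Lemma cexp_continuous1 (w : C) : N w <= 1 / 2 -> N (cexp w - 1) <= 3 * N w.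
Proof.
move=> w2; have h1 := cexp_second_order w2.
have h2 := ler_normc_dist (cexp w - 1) w.
have h3 : N w ^+ 2 <= 1 / 2 * N w by rewrite expr2 ler_wpM2r // normc_ge0.
lra.
Qed.

(** If [Q'(0, 0)] were nonzero, [Q'] would have no zero near the origin. The family gives zeros of
    [x ^+ m * Q'(x, y)] near it, with [x != 0] because the real part moves. *)
Lemma crossing_branch (n : nat) (A B : 'M[R]_n) (tau w : R) (lam : R -> C) :
  transverse_crossing A B tau w lam ->
  exists2 Z, acs_branch A B w Z & Z w = cexp (- ((0 +i* w) * tau%:C)).
Proof.
move=> [w0 lamtau /near_distP[d d0 hd] dalpha alpha0].
set l0 := 0 +i* w in lamtau *; set y0 := cexp _.
have [Q Q0 QE] := char_poly2 (cmx A) (cmx B) l0 y0.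
have [m [Q' [QQ' Qy]]] := extract_fst_power Q0.
apply: (@acs_branch_of_root _ A B w y0 m Q') => //.
- by rewrite -QQ'; exact: QE.
- exact: cexp_neq0.
apply/eqP/negPn/negP; rewrite -normc_gt0; set M := N _ => M0.
have [K K0 lK] := bipoly_lipschitz 1 (bipoly_horner2 Q').
have lamc : ccontinuous_at lam tau by have [] := hd tau; rewrite // subrr normr0.
(* When [x] and [y] have modulus at most [e], the Lipschitz bound is at most [2 / 3 * M], less than
   [M]. *)
pose e := Num.min 1 (M / (3 * K)).
have e0 : 0 < e by rewrite lt_min ltr01 divr_gt0 ?mulr_gt0.
have e1 : e <= 1 by rewrite ge_min lexx.
have eM : e <= M / (3 * K) by rewrite ge_min lexx orbT.
(* Bounds the increment [z] of the exponent: [b <= 1 / 2] and [3 * N y0 * b <= e], so that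
   [N z <= b] yields [N (y t) <= e]. *)
pose b := e / (3 * N y0 + 2).
have y0g := normc_ge0 y0.
have B0 : 0 < 3 * N y0 + 2 by lra.
have b0 : 0 < b by rewrite divr_gt0.
have bE : b * (3 * N y0 + 2) = e by rewrite /b divfK // gt_eqF.
have b3 : 3 * N y0 * b <= e by rewrite -bE; lra.
have b2 : b <= 1 / 2.
  have : b * 2 <= e by rewrite -bE ler_pM2l // lerDr mulr_ge0.
  lra.
have be : b <= e by rewrite -bE ler_pMr //; lra.
pose L := `|tau| + 1 + N l0.
have L1 : 1 <= L by rewrite /L -addrA addrCA lerDl addr_ge0 ?normc_ge0.
have L0 : 0 < L by rewrite (lt_le_trans ltr01).
pose x t := lam t - l0; pose y t := cexp (- (lam t * t%:C)) - y0.
have f0 : 0 < b / L / 2 by rewrite !divr_gt0.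
have [d1 d10 h1] := (ccontinuous_distP lam tau).1 lamc _ f0.
have a2 : 0 < `|derive1 (fun t => complex.Re (lam t)) tau| / 2.
  by rewrite divr_gt0 // normr_gt0.
have [d2 d20 h2] := derivable_dist dalpha a2.
pose s := Num.min (Num.min d 1) (Num.min (Num.min d1 d2) (b / L / 2)) / 2.
have m0 : 0 < Num.min (Num.min d 1) (Num.min (Num.min d1 d2) (b / L / 2)).
  by rewrite !lt_min d0 d10 d20 f0 ltr01.
have s0 : 0 < s by rewrite divr_gt0.
have : s < Num.min (Num.min d 1) (Num.min (Num.min d1 d2) (b / L / 2)).
  by rewrite /s gtr_pMr // invf_lt1 ?ltr1n.
rewrite !lt_min => /andP[/andP[sd s1] /andP[/andP[sd1 sd2] sb]].
pose t := tau + s; have ts : t - tau = s by rewrite /t addrC addKr.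
have xb : N (x t) <= b / L / 2 by rewrite /x -lamtau h1 // ts gtr0_norm.
have xN0 : x t != 0.
  (* Otherwise the difference quotient of the real part would be [0], too far from its nonzero
     limit. *)
  apply/eqP => x0; have := h2 s; rewrite gt_eqF // gtr0_norm // => /(_ isT sd2).
  have -> : lam (tau + s) = lam tau by rewrite lamtau; exact: subr0_eq x0.
  rewrite subrr mul0r sub0r normrN; move: a2; set a := `|_|; lra.
have QE0 : Q'.[(y t)%:P].[x t] = 0.
  have [|h _] := hd t; first by rewrite ts gtr0_norm.
  move: h; rewrite (char_poly2_char_fun _ _ QE) QQ' !hornerM hornerC hornerXn.
  by move/eqP; rewrite mulf_eq0 expf_eq0 (negbTE xN0) andbF => /eqP.
pose z := - (x t * t%:C + l0 * s%:C).
have zb : N z <= b.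
  rewrite /z normc_opp; apply: le_trans (ler_normcD _ _) _.
  rewrite !Normc.normcM !normc_real (gtr0_norm s0).
  have tL : `|t| <= `|tau| + 1.
    by apply: le_trans (ler_normD _ _) _; rewrite lerD2l gtr0_norm // ltW.
  apply: (@le_trans _ _ (b / L / 2 * (`|tau| + 1) + N l0 * (b / L / 2))).
    apply: lerD; apply: ler_pM; rewrite ?normc_ge0 ?normr_ge0 ?(ltW s0) ?(ltW sb) //.
  have -> : b / L / 2 * (`|tau| + 1) + N l0 * (b / L / 2) = b / L / 2 * L.
    by rewrite /L; ring.
  by rewrite mulrAC divfK ?gt_eqF // ler_pdivrMr // ler_pMr // ler1n.
have yE : y t = y0 * (cexp z - 1).
  rewrite /y mulrBr mulr1 -cexpD; congr (cexp _ - _).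
  by rewrite /z /x /t rmorphD; ring.
have yb : N (y t) <= e.
  rewrite yE Normc.normcM; apply: le_trans b3; rewrite -mulrA mulrCA.
  apply: ler_wpM2l => //; apply: le_trans (cexp_continuous1 (le_trans zb b2)) _.
  by rewrite ler_pM2l.
have xe : N (x t) <= e.
  apply: le_trans be; apply: le_trans xb _.
  by rewrite -mulrA ler_piMr ?(ltW b0) // mulr_ile1 ?invr_ge0 ?invf_le1 ?(ltW L0) // ler1n.
have := lK 0 0 (x t) (y t).
rewrite QE0 subr0 -/M Normc.normc0 !sub0r !normc_opp ler01.
rewrite (le_trans xe e1) (le_trans yb e1) => /(_ isT isT isT isT).
apply/negP; rewrite -ltNge.
apply: (@le_lt_trans _ _ (K * (e + e))); first by rewrite ler_pM2l // lerD.
apply: (@le_lt_trans _ _ (K * (M / (3 * K) + M / (3 * K)))).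
  by rewrite ler_pM2l // lerD.
have -> : K * (M / (3 * K) + M / (3 * K)) = 2 / 3 * M by field; rewrite gt_eqF.
lra.
Qed.

End CrossingsAndSpectrum.

(** * Crossings at the delays of a spectral branch: existence, direction, completeness *)

Theorem theorem3p2 (R : realType) (n : nat) (A B : 'M[R]_n)
    (wH : R) (Y : R -> R[i])
    (wH_gt0 : 0 < wH)
    (Y_branch : acs_branch A B wH Y)
    (Y_root : acs_root A B wH (Y wH))
    (Y_diff : cderivable_at Y wH)
    (gamma0 : acs_gamma Y wH = 0)
    (dgamma : derive1 (acs_gamma Y) wH != 0) :
  (forall k : int, exists lam : R -> R[i],
     [/\ transverse_crossing A B (crossing_delay wH (Y wH) k) wH lam,
         derive1 (acs_gamma Y) wH < 0 ->
           destabilizing (crossing_delay wH (Y wH) k) lam &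
         0 < derive1 (acs_gamma Y) wH ->
           stabilizing (crossing_delay wH (Y wH) k) lam]) /\
  ((forall (w : R) (Z : R -> R[i]), 0 < w -> acs_branch A B w Z ->
      acs_gamma Z w = 0 -> w = wH /\ Z w = Y wH) ->
   forall (tau0 w : R) (lam : R -> R[i]),
     transverse_crossing A B tau0 w lam ->
     w = wH /\ exists k : int, tau0 = crossing_delay wH (Y wH) k).
Proof.
have wH0 : wH != 0 by rewrite gt_eqF.
have Y1 : N (Y wH) = 1.
  (* By [ln 0 = 0], gamma would also vanish at [Y wH = 0]; [acs_root] rules that out, leaving
     modulus [1]. *)
  have [_ _ Y0] := Y_root; move/eqP: gamma0; rewrite oppr_eq0 ln_eq0 ?normc_gt0 //.
  by move/eqP.
split=> [k|unique tau w lam cross].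
  have [lam [cross [c c0 dE]]] := crossing_at_delay wH_gt0 Y_branch Y_diff Y1
    dgamma (cexp_crossing_delay k wH0 Y1).
  exists lam; split => // h; rewrite /destabilizing /stabilizing dE.
    by rewrite oppr_gt0 pmulr_rlt0.
  by rewrite oppr_lt0 mulr_gt0.
have [w0 _ _ _ _] := cross; have [Z Zb ZE] := crossing_branch cross.
have [|wE ZY] := unique w Z w0 Zb.
  (* The exponential of an imaginary number has modulus [1], so gamma vanishes on this branch at
     [w]. *)
  by rewrite /acs_gamma ZE cexp_crossing -cexp_imaginary normc_cexp /= expR0 ln1 oppr0.
split=> //; apply: crossing_delay_unique => //.
by rewrite -ZY ZE wE.
Qed.
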